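(* Let $\Omega\subset\mathbb{R}^d$ be an open neighbourhood of $\mathbf{0}$, $k\ge1$, $K\in\mathcal{C}^{(k+1,k+1)}(\Omega\times\Omega)$, $\mathbf{x}_1,\ldots,\mathbf{x}_n\in\mathbb{R}^d$ with $\#\mathbb{P}_{k-1}<n\le\#\mathbb{P}_k$, $\ell=\#\mathbb{P}_k-n$, and $\mathbf{K}_\varepsilon=[K(\varepsilon\mathbf{x}_i,\varepsilon\mathbf{x}_j)]_{i,j=1}^n$. Assume that for some $\varepsilon_0>0$, $\mathbf{K}_\varepsilon$ is symmetric positive semidefinite on $[0,\varepsilon_0]$ and analytic in $\varepsilon$ near $0$. List its eigenvalues (for small $\varepsilon>0$) in nonincreasing order and split them consecutively into groups $s=0,1,\ldots,k$ of sizes $N_s=\#\mathbb{H}_s$ for $s<k$ and $N_k=\#\mathbb{H}_k-\ell$, denoting them $\lambda_{s,j}(\varepsilon)$, $1\le j\le N_s$, with limiting eigenvectors $\mathbf{p}_{s,j}$. Then $\lambda_{s,j}(\varepsilon)=\varepsilon^{2s}(\widetilde\lambda_{s,j}+\mathcal{O}(\varepsilon))$ for real numbers $\widetilde\lambda_{s,j}$, where $\widetilde\lambda_{0,1}=nK(\mathbf{0},\mathbf{0})$, and: 1. For $1\le s<k$, if $\det\mathbf{W}_{s-1}\neq0$ and $\mathbf{V}_{\le s-1}$ has full column rank, then \[\prod_{j=1}^{\#\mathbb{H}_s}\widetilde\lambda_{s,j}=\frac{\det(\mathbf{V}_{\le s}^\top\mathbf{V}_{\le s})\det(\mathbf{W}_s)}{\det(\mathbf{V}_{\le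 s-1}^\top\mathbf{V}_{\le s-1})\det(\mathbf{W}_{s-1})}.\] 2. For $1\le s\le k$, if $\det\mathbf{W}_{s-1}\neq0$ and $\mathbf{V}_{\le s-1}$ has full column rank, then $\widetilde\lambda_{s,1},\ldots,\widetilde\lambda_{s,N_s}$ are the eigenvalues of $\mathbf{Q}_s^\top\mathbf{V}_s\widetilde{\mathbf{W}}\mathbf{V}_s^\top\mathbf{Q}_s$, where $\widetilde{\mathbf{W}}=\mathbf{W}_{\lrcorner}-\mathbf{W}_{\llcorner}\mathbf{W}_{s-1}^{-1}\mathbf{W}_{\urcorner}$ comes from the partition $\mathbf{W}_s=\begin{bmatrix}\mathbf{W}_{s-1}&\mathbf{W}_{\urcorner}\\\mathbf{W}_{\llcorner}&\mathbf{W}_{\lrcorner}\end{bmatrix}$ (with $\mathbf{W}_{\lrcorner}$ indexed by $\mathbb{H}_s\times\mathbb{H}_s$). 3. For $0\le s<k$, if $\det\mathbf{W}_s\neq0$ and $\mathbf{V}_{\le s}$ has full column rank, then $\mathbf{p}_{s,1},\ldots,\mathbf{p}_{s,\#\mathbb{H}_s}$ span the column space of $\mathbf{Q}_s$. Moreover, if $\det\mathbf{W}_{k-1}\neq0$ and $\mathbf{V}_{\le k-1}$ has full column rank, the remaining limiting eigenvectors $\mathbf{p}_{k,1},\ldots,\mathbf{p}_{k,N_k}$ span the column space of $\mathbf{Q}_k$. Here $\mathbf{Q}_{\rm full}=[\mathbf{Q}_0\ \mathbf{Q}_1\cdots\mathbf{Q}_k]$ is the orthogonal factor of a full QR factorization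 of $\mathbf{V}_{\le k-1}$, partitioned so that $\mathbf{Q}_s\in\mathbb{R}^{n\times\#\mathbb{H}_s}$ for $s<k$ and $\mathbf{Q}_k\in\mathbb{R}^{n\times(\#\mathbb{H}_k-\ell)}$.
   Context: Multi-indices $\boldsymbol\alpha\in\mathbb{Z}_+^d$: $|\boldsymbol\alpha|=\sum_i\alpha_i$, $\boldsymbol\alpha!=\prod_i\alpha_i!$, $\mathbf{x}^{\boldsymbol\alpha}=\prod_ix_i^{\alpha_i}$; $\mathbb{P}_k=\{|\boldsymbol\alpha|\le k\}$, $\mathbb{H}_k=\{|\boldsymbol\alpha|=k\}$, $\#\mathbb{P}_k=\binom{k+d}{d}$, $\#\mathbb{H}_k=\binom{k+d-1}{d-1}$ (so $\#\mathbb{H}_0=1$, $\#\mathbb{H}_1=d$). A fixed graded total order on multi-indices is used. $\mathbf{V}_{\mathcal{A}}=[\mathbf{x}_i^{\boldsymbol\alpha}]_{i\le n,\boldsymbol\alpha\in\mathcal{A}}$ (columns in the chosen order), $\mathbf{V}_{\le k}=\mathbf{V}_{\mathbb{P}_k}$, $\mathbf{V}_k=\mathbf{V}_{\mathbb{H}_k}$. $K\in\mathcal{C}^{(k,k)}(\Omega\times\Omega)$ means all $K^{(\boldsymbol\alpha,\boldsymbol\beta)}=\partial^{\boldsymbol\alpha}_{\mathbf{x}}\partial^{\boldsymbol\beta}_{\mathbf{y}}K$, $\boldsymbol\alpha,\boldsymbol\beta\in\mathbb{P}_k$, exist and are continuous. Wronskian $\mathbf{W}_s=\Big[\frac{K^{(\boldsymbol\alpha,\boldsymbol\beta)}(\mathbf{0},\mathbf{0})}{\boldsymbol\alpha!\boldsymbol\beta!}\Big]_{\boldsymbol\alpha,\boldsymbol\beta\in\mathbb{P}_s}$.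 Full QR: $\mathbf{V}=\mathbf{Q}_{\rm full}\begin{bmatrix}\mathbf{R}\\\mathbf{0}\end{bmatrix}$, $\mathbf{Q}_{\rm full}$ orthogonal, $\mathbf{R}$ upper triangular. Limiting eigenvectors: for a matrix analytic in $\varepsilon$ and symmetric for real $\varepsilon$, eigenvalues and orthogonal rank-one eigenprojectors $\mathbf{P}(\varepsilon)$ can be chosen analytic near $0$; the limiting eigenvector $\mathbf{p}$ is a unit vector with $\mathbf{P}(0)=\mathbf{p}\mathbf{p}^\top$. *)

(* Defs.v *)
From HB Require Import structures.
From mathcomp Require Import all_boot all_order all_algebra.
From mathcomp Require Import all_classical all_reals all_analysis.
Set Implicit Arguments. Unset Strict Implicit. Unset Printing Implicit Defensive.
Import Order.TTheory GRing.Theory Num.Theory.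
Import numFieldNormedType.Exports.
Local Open Scope classical_set_scope.
Local Open Scope ring_scope.

Definition mi (d : nat) := {ffun 'I_d -> nat}.
Definition mdeg d (a : mi d) : nat := (\sum_(i < d) a i)%N.
Definition mfact d (a : mi d) : nat := (\prod_(i < d) (a i)`!)%N.
Definition mi0 d : mi d := [ffun => 0%N].

Section Defs.
Variable R : realType.
Variable d : nat.

Definition mono (a : mi d) (x : 'rV[R]_d) : R := \prod_(l < d) x 0 l ^+ a l.

(* A graded total order on multi-indices is given by an enumeration
   H s (duplicate-free) of the multi-indices of degree exactly s, for each s. *)
Definition graded_enum (H : nat -> seq (mi d)) : Prop :=
  forall s, uniq (H s) /\ forall a, (a \in H s) = (mdeg a == s).

Definition Plt (H : nat -> seq (mi d)) (s : nat) : seq (mi d) :=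
  flatten [seq H t | t <- iota 0 s].

Definition Vmx n (x : 'I_n -> 'rV[R]_d) (A : seq (mi d)) : 'M[R]_(n, size A) :=
  \matrix_(i < n, j < size A) mono (nth (mi0 d) A j) (x i).

Fixpoint dseq (ws : seq ('rV[R]_d * 'rV[R]_d)) (f : 'rV[R]_d * 'rV[R]_d -> R)
  : 'rV[R]_d * 'rV[R]_d -> R :=
  match ws with
  | [::] => f
  | w :: ws' => fun z => derive (dseq ws' f) z w
  end.

Definition ex (i : 'I_d) : 'rV[R]_d * 'rV[R]_d := (delta_mx 0 i, 0).
Definition ey (i : 'I_d) : 'rV[R]_d * 'rV[R]_d := (0, delta_mx 0 i).

(* directions for d_x^alpha d_y^beta (y-derivatives applied first) *)
Definition dirs (a b : mi d) : seq ('rV[R]_d * 'rV[R]_d) :=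
  flatten [seq nseq (a i) (ex i) | i <- enum 'I_d] ++
  flatten [seq nseq (b i) (ey i) | i <- enum 'I_d].

Definition Kder (K : 'rV[R]_d * 'rV[R]_d -> R) (a b : mi d) := dseq (dirs a b) K.

(* K in C^{(k,k)}(Omega x Omega): all K^{(alpha,beta)}, |alpha|,|beta| <= k, exist
   (each successive partial derivative exists) and are continuous on Omega x Omega *)
Definition Ckk (k : nat) (Om : set 'rV[R]_d) (K : 'rV[R]_d * 'rV[R]_d -> R) : Prop :=
  forall a b : mi d, (mdeg a <= k)%N -> (mdeg b <= k)%N ->
  forall z, z \in Om `*` Om ->
    {for z, continuous (Kder K a b)} /\
    (match dirs a b with
     | [::] => True
     | w :: ws => derivable (dseq ws K) z w
     end).

Definition Wmx (K : 'rV[R]_d * 'rV[R]_d -> R) (A B : seq (mi d)) : 'M[R]_(size A, size B) :=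
  \matrix_(i < size A, j < size B)
    (Kder K (nth (mi0 d) A i) (nth (mi0 d) B j) (0, 0) /
     ((mfact (nth (mi0 d) A i))%:R * (mfact (nth (mi0 d) B j))%:R)).

Definition Keps n (K : 'rV[R]_d * 'rV[R]_d -> R) (x : 'I_n -> 'rV[R]_d) (e : R)
  : 'M[R]_n := \matrix_(i, j) K (e *: x i, e *: x j).

End Defs.

Section Gen.
Variable R : realType.

Definition analytic0 (f : R -> R) : Prop :=
  exists r : R, 0 < r /\ exists c : nat -> R,
    forall e : R, `|e| < r ->
      ((fun N : nat => \sum_(0 <= j < N) c j * e ^+ j) @ \oo) --> f e.

Definition mx_analytic0 m n (F : R -> 'M[R]_(m, n)) : Prop :=
  forall i j, analytic0 (fun e => F e i j).

Definition psdmx n (A : 'M[R]_n) : Prop :=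
  forall v : 'cV[R]_n, 0 <= (v^T *m A *m v) 0 0.

(* the n x N block of columns lo, lo+1, ..., lo+N-1 of an n x m matrix *)
Definition colblock n m (M : 'M[R]_(n, m)) (lo N : nat) : 'M[R]_(n, N) :=
  \matrix_(i < n, j < N) \sum_(l < m | val l == (lo + j)%N) M i l.
End Gen.

(* index i (0-based, eigenvalues sorted nonincreasingly) belongs to group s,
   i.e. #P_{s-1} <= i < #P_s *)
Definition grp d (H : nat -> seq (mi d)) n (s : nat) (i : 'I_n) : bool :=
  (size (Plt H s) <= i < size (Plt H s.+1))%N.
(* size N_s of group s (= #H_s for s < k, = #H_k - l for s = k) *)
Definition Ns d (H : nat -> seq (mi d)) (n s : nat) : nat :=
  (minn (size (Plt H s.+1)) n - size (Plt H s))%N.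

(* Main.v *)
(* Apply a pair of functionals u, v supported on the nodes to K(e x_i, e x_j).
   If u kills all monomials of degree < s and v those of degree < t, Taylor
   expansion first in x, then in y, gives
     u^T K_e v = e^(s+t) (u^T V_s W_(s,t) V_t^T v + o(1)).
   Compressing K_e to the kernel of V_(<=s-1)^T, the min-max principle yields
   lam_i = O(e^(2s)) from the group s on, and analyticity turns this into
   lam_i = e^(2s) (lt_i + O(e)).  When V = V_(<=s-1) has full column rank, the
   columns of V (V^T V)^-1 are dual to the monomials; completed by a basis of
   ker V^T they give a basis in which K_e + c e^N, suitably rescaled, has a
   limit.  Its determinant is compared with the product of the lam_i + c e^N:
   a shift dominating the eigenvalues beyond V isolates det W_(s-1), while the
   shift c e^(2s), with c arbitrary, yields the characteristic polynomial of the
   Schur complement.  Finally, if u is orthogonal to V_(<=s-1) then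
   lam_i (u^T P_i u) <= u^T K_e u = O(e^(2s)), so that u is orthogonal to the
   limiting eigenvectors of all previous groups. *)
Require Import Defs.
From HB Require Import structures.
From mathcomp Require Import all_boot all_order all_algebra.
From mathcomp Require Import all_classical all_reals all_analysis.
From mathcomp Require Import ring lra.
Import Order.TTheory GRing.Theory Num.Theory.
Import numFieldNormedType.Exports.
Local Open Scope classical_set_scope.
Local Open Scope ring_scope.

(** [Ckk] provides each derivative in one fixed order only, x-derivatives outside y-derivatives, and
    partial derivatives are never exchanged. Hence the Taylor estimates move along the coordinate
    axes in an order that only ever prepends a derivative, and expand in x before y. Later [lt i]
    may vanish, so the groups before S cannot be isolated by dividing determinants of K_e itself.
    The shift replaces the later factors by ones with known nonzero limits: e^(2S-1) lies strictly
    between the scale e^(2S-2) of the last eigenvalues kept and the scale e^(2S) of the others. Item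
    1 assumes neither det W_s nonzero nor V_(<=s) of full rank, so [det_gram_Wmx] also covers the
    degenerate cases, and item 1 is a quotient of two of its instances. Positivity is given for e >=
    0 only, so all limits are taken from the right; analyticity makes such one-sided bounds
    enough. *)

Set Implicit Arguments. Unset Strict Implicit. Unset Printing Implicit Defensive.

(** * Functions analytic at 0 *)

Section Analytic.
Variable R : realType.
Implicit Types (f : R -> R) (e : R).

(** At a point q inside the disc of convergence the terms [c j * q ^+ j] are bounded, so for
    [|e| < q / 2] the tail is dominated by a geometric series of ratio at most 1/2. The same [c]
    serves every order [N]. *)
Lemma analytic0_expansion f : analytic0 f ->
  exists c : nat -> R, forall N, exists C d : R, 0 < d /\
    forall e, `|e| < d -> `|f e - \sum_(0 <= j < N) c j * e ^+ j| <= C * `|e| ^+ N.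
Proof.
move=> [r [r0 [c hc]]]; exists c => N.
pose q := r / 2.
have q0 : 0 < q by rewrite divr_gt0.
have qr : `|q| < r by rewrite gtr0_norm// /q; lra.
have cvq : cvgn (series (fun j => c j * q ^+ j)).
  by apply/cvg_ex; exists (f q); exact: hc.
have [M1 [_ /(_ (M1 + 1) (ltr_pwDr ltr01 (lexx M1))) hM]] :=
  cvg_seq_bounded (cvgP _ (cvg_series_cvg_0 cvq)).
pose M := M1 + 1.
have hM' j : `|c j| * q ^+ j <= M.
  have : `|c j * q ^+ j| <= M := hM j I.
  by rewrite normrM (ger0_norm (exprn_ge0 _ (ltW q0))).
have M0 : 0 <= M by apply: le_trans (hM' 0%N); rewrite mulr_ge0.
exists (M * 2 / q ^+ N), (q / 2); split; first by rewrite divr_gt0.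
move=> e he.
have er : `|e| < r by apply: lt_trans he _; rewrite /q; lra.
pose t := `|e| / q.
have t0 : 0 <= t by rewrite divr_ge0 // ltW.
have t2 : t <= 1/2 by rewrite /t ler_pdivrMr // ltW // mulrC mulrA mulr1.
(* Subtracting [2 * t ^+ J] makes the induction close, by [t <= 1/2]. *)
have tail J : (N <= J)%N -> \sum_(N <= j < J) t ^+ j <= 2 * t ^+ N - 2 * t ^+ J.
  elim: J => [|J IH].
    by rewrite leqn0 => /eqP ->; rewrite big_geq // !expr0; lra.
  rewrite leq_eqVlt => /orP[/eqP<-|].
    by rewrite big_geq //; have := exprn_ge0 N t0; lra.
  rewrite ltnS => NJ; rewrite big_nat_recr //=.
  have := IH NJ; have tJ := exprn_ge0 J t0.
  rewrite exprS.
  have : t * t ^+ J <= 1/2 * t ^+ J by rewrite ler_wpM2r.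
  have : 0 <= t * t ^+ J by rewrite mulr_ge0.
  lra.
have bd J : (N <= J)%N ->
    `|\sum_(0 <= j < J) c j * e ^+ j - \sum_(0 <= j < N) c j * e ^+ j|
      <= M * 2 / q ^+ N * `|e| ^+ N.
  move=> NJ; rewrite (big_cat_nat (n := N)) //= addrAC subrr add0r.
  apply: le_trans (ler_norm_sum _ _ _) _.
  apply: (@le_trans _ _ (\sum_(N <= j < J) M * t ^+ j)).
    apply: ler_sum => j _; rewrite normrM normrX.
    have -> : `|e| ^+ j = q ^+ j * t ^+ j.
      by rewrite -exprMn /t mulrCA divff ?mulr1 // gt_eqF.
    by rewrite mulrA ler_wpM2r ?exprn_ge0.
  rewrite -mulr_sumr.
  have -> : M * 2 / q ^+ N * `|e| ^+ N = M * (2 * t ^+ N).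
    by rewrite /t (expr_div_n `|e| q) -!mulrA [_^-1 * _]mulrC.
  apply: ler_wpM2l => //.
  by have := tail _ NJ; have := exprn_ge0 J t0; lra.
have cv := hc e er.
have cv' : `|\sum_(0 <= j < J) c j * e ^+ j - \sum_(0 <= j < N) c j * e ^+ j|
   @[J --> \oo] --> `|f e - \sum_(0 <= j < N) c j * e ^+ j|.
  by apply: cvg_norm; apply: cvgB => //; exact: cvg_cst.
rewrite -(cvg_lim _ cv') //; apply: limr_le; first by apply/cvg_ex; eexists; exact: cv'.
by exists N => // J /= NJ; exact: bd.
Qed.

Lemma at_right_bound (C d : R) f N : 0 < d ->
  (forall e, 0 < e < d -> `|f e| <= C * e ^+ N.+1) ->
  (fun e => f e / e ^+ N) @ 0^'+ --> (0 : R).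
Proof.
move=> d0 hf; apply/cvgrPdist_le => w w0.
have C0 : 0 < `|C| + 1 by rewrite ltr_wpDl.
near=> e; rewrite sub0r normrN normrM normfV.
have e0 : 0 < e by near: e; exact: nbhs_right_gt.
have ed : e < d by near: e; exact: nbhs_right_lt.
rewrite (gtr0_norm (exprn_gt0 _ e0)) ler_pdivrMr ?exprn_gt0 //.
apply: le_trans (hf e _) _; first by rewrite e0.
rewrite exprS mulrA; apply: ler_wpM2r; first by rewrite exprn_ge0 // ltW.
apply: (@le_trans _ _ ((`|C| + 1) * e)).
  by rewrite ler_pM2r //; have := ler_norm C; lra.
rewrite mulrC -ler_pdivlMr //.
by near: e; apply: nbhs_right_le; rewrite divr_gt0.
Unshelve. all: by end_near. Qed.

(** A one-sided bound of order [N] kills the coefficients below [N]; the next one is the leading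
    term. *)
Lemma analytic0_leading_term f N (C d : R) : analytic0 f -> 0 < d ->
  (forall e, 0 < e < d -> `|f e| <= C * e ^+ N) ->
  exists a C' d' : R, 0 < d' /\
    forall e, 0 < e < d' -> `|f e - e ^+ N * a| <= C' * e ^+ N.+1.
Proof.
move=> /analytic0_expansion [c hc] d0 hf.
(* Once the earlier coefficients vanish, [c j * e ^+ j / e ^+ j] tends to 0 by the bound, yet is
   constantly [c j]. *)
have c0 j : (j < N)%N -> c j = 0.
  elim/ltn_ind: j => j IH jN.
  have [C1 [d1 [d10 h1]]] := hc j.+1.
  have cvc : (fun e => (c j * e ^+ j) / e ^+ j) @ 0^'+ --> (0 : R).
    apply: (@at_right_bound (C1 + `|C|) (Num.min 1 (Num.min d d1))).
      by rewrite !lt_min ltr01 d0 d10.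
    move=> e /andP[e0]; rewrite !lt_min => /and3P[e1 ed ed1].
    have := h1 e; rewrite gtr0_norm // => /(_ ed1).
    rewrite big_nat_recr //= big_nat big1 ?add0r; last first.
      by move=> l /andP[_ lj]; rewrite IH ?mul0r // (ltn_trans lj).
    move=> h2; have := hf e; rewrite e0 ed => /(_ isT) h3.
    have h4 : C * e ^+ N <= `|C| * e ^+ j.+1.
      apply: (@le_trans _ _ (`|C| * e ^+ N)).
        by rewrite ler_wpM2r ?ler_norm // exprn_ge0 // ltW.
      by rewrite ler_wpM2l // ler_wiXn2l // ltW.
    have := ler_normB (f e) (f e - c j * e ^+ j).
    rewrite opprB addrC subrK mulrDl.
    lra.
  have : (fun e => (c j * e ^+ j) / e ^+ j) @ 0^'+ --> c j.
    apply: (@cvg_trans _ ((fun=> c j) @ (0:R)^'+)); last exact: cvg_cst.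
    apply: near_eq_cvg; near=> e.
    have e0 : 0 < e by near: e; exact: nbhs_right_gt.
    by rewrite mulfK // expf_neq0 // gt_eqF.
  by move=> h5; apply: (cvg_unique _ h5 cvc).
have [C1 [d1 [d10 h1]]] := hc N.+1.
exists (c N), C1, d1; split=> // e /andP[e0 ed].
have := h1 e; rewrite gtr0_norm // => /(_ ed).
rewrite big_nat_recr //= big_nat big1 ?add0r; last first.
  by move=> l /andP[_ lj]; rewrite c0 ?mul0r.
by rewrite mulrC.
Unshelve. all: by end_near. Qed.

Lemma analytic0_at_right f : analytic0 f -> f e @[e --> 0^'+] --> f 0.
Proof.
move=> /analytic0_expansion [c hc].
have [C [d [d0 h]]] := hc 1%N.
have := h 0; rewrite normr0 => /(_ d0); rewrite big_nat1 !expr0 expr1 !mulr1 mulr0.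
rewrite normr_le0 subr_eq0 => /eqP ->.
have : (fun e => (f e - c 0%N) / e ^+ 0) @ 0^'+ --> (0 : R).
  apply: (@at_right_bound C d) => // e /andP[e0 ed].
  have := h e; rewrite gtr0_norm // => /(_ ed).
  by rewrite big_nat1 expr0 mulr1.
move=> cv.
have fE : f = (fun e => c 0%N + (f e - c 0%N) / e ^+ 0).
  by apply/funext => e; rewrite expr0 divr1 addrC subrK.
rewrite {1}fE -[X in _ --> X]addr0; apply: cvgD => //; exact: cvg_cst.
Qed.

End Analytic.

(** * Taylor expansion in decreasing order of the variables *)

Section Taylor.
Variables (R : realType) (d : nat).
Implicit Types (a b c g : mi d) (y : 'rV[R]_d).

Definition mi_incr a (i : 'I_d) : mi d := [ffun j => (a j + (j == i))%N].

Lemma mdeg_incr a i : mdeg (mi_incr a i) = (mdeg a).+1.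
Proof.
rewrite /mdeg; under eq_bigr do rewrite ffunE.
rewrite big_split /= [X in (_ + X)%N](bigD1 i) //= eqxx.
by rewrite [X in (_ + (_ + X))%N]big1 ?addn0 ?addn1 // => j /negPf ->.
Qed.

(** A directional derivative depends only on the difference quotients along its line, so it can be
    moved between the product space, the row vectors and the real line. *)
Lemma is_derive_transfer (V W : normedModType R) (F : V -> R) (f : W -> R)
    (a0 v : V) (b0 w : W) (D : R) :
  (forall h, f (h *: w + b0) = F (h *: v + a0)) ->
  is_derive a0 v F D -> is_derive b0 w f D.
Proof.
move=> E [dF DF].
have E0 : f b0 = F a0 by have := E 0; rewrite !scale0r !add0r.
have EE : (fun h => h^-1 *: ((f \o shift b0) (h *: w) - f b0)) =
          (fun h => h^-1 *: ((F \o shift a0) (h *: v) - F a0)).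
  by apply/funext => h /=; rewrite E E0.
by apply: DeriveDef; rewrite ?/derivable ?/derive EE.
Qed.

Lemma mean_value0 (f df : R -> R) (x : R) :
  (forall z : R, `|z| <= `|x| -> is_derive z 1 f (df z)) ->
  exists2 z, `|z| <= `|x| & f x - f 0 = df z * x.
Proof.
move=> hf.
have cont (i : interval R) : {in i, forall z : R, `|z| <= `|x|} ->
    {within [set` i], continuous f}.
  by move=> hi; apply: derivable_within_continuous => z /hi/hf [].
case: (leP 0 x) => x0.
  have le z : z \in `[0, x] -> `|z| <= `|x|.
    by rewrite in_itv /= => /andP[z0 zx]; rewrite !ger0_norm.
  have [z|z /le zx] := @MVT_segment R f df 0 x x0 _ (cont _ le).
    move=> zi; apply: hf; apply: le; apply: subset_itv_oo_cc zi.
  by rewrite subr0; exists z.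
have le z : z \in `[x, 0] -> `|z| <= `|x|.
  by rewrite in_itv /= => /andP[z0 zx]; rewrite !ler0_norm ?lerN2 // ltW.
have [z|z /le zx] := @MVT_segment R f df x 0 (ltW x0) _ (cont _ le).
  move=> zi; apply: hf; apply: le; apply: subset_itv_oo_cc zi.
by rewrite sub0r => hz; exists z => //; lra.
Qed.

Lemma mean_value_line (F dF : 'rV[R]_d -> R) y (v : 'rV[R]_d) (x : R) :
  (forall z, `|z| <= `|x| -> is_derive (y + z *: v) v F (dF (y + z *: v))) ->
  exists2 z, `|z| <= `|x| & F (y + x *: v) - F y = dF (y + z *: v) * x.
Proof.
move=> hF; have [|z zx] := @mean_value0 (fun z => F (y + z *: v))
  (fun z => dF (y + z *: v)) x; last by rewrite scale0r addr0; exists z.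
move=> z /hF; apply: is_derive_transfer => h.
by rewrite [h *: 1]mulr1 scalerDl addrCA.
Qed.

(* The factors of [mi_incr] are only added in front of all others: the family
   [G] consists of derivatives taken in decreasing order of the variables. *)
Definition derivative_family (t : nat) (rho : R) (G : mi d -> 'rV[R]_d -> R) :=
  forall g (i : 'I_d) y, (mdeg g < t)%N -> (forall j : 'I_d, (j < i)%N -> g j = 0%N) ->
    (forall l, `|y 0 l| < rho) ->
    is_derive y (delta_mx 0 i) (G g) (G (mi_incr g i) y).

(** Iterated mean values: each of the [t] levels walks through at most [d] coordinates by steps of
    length at most [r]. *)
Lemma derivative_family_bound t (rho r w : R) G : derivative_family t rho G -> 0 <= r < rho ->
  (forall g, (mdeg g < t)%N -> G g 0 = 0) ->
  (forall g y, mdeg g = t -> (forall l, `|y 0 l| <= r) -> `|G g y| <= w) ->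
  forall y, (forall l, `|y 0 l| <= r) -> `|G (mi0 d) y| <= (d%:R * r) ^+ t * w.
Proof.
move=> hG /andP[r0 rrho] G0 Gw.
(* Increasing the coordinates of 0 to those of [y] one by one keeps the
   coordinates after [p] zero while differentiating in direction [p]. *)
suff main m : forall g l y, (mdeg g + m)%N = t ->
    (forall j : 'I_d, (j < l)%N -> g j = 0%N) ->
    (forall j : 'I_d, (l < j)%N -> y 0 j = 0) ->
    (forall j, `|y 0 j| <= r) -> `|G g y| <= (d%:R * r) ^+ m * w.
  (* [l] bounds the support of [g] from below and that of [y] from above; for [g = 0] the choice
     [l = d] leaves [y] unrestricted. *)
  move=> y hy; apply: (main t _ d) => //.
  - by rewrite /mdeg big1 // => i _; rewrite ffunE.
  - by move=> j _; rewrite ffunE.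
  - by move=> j; rewrite ltnNge ltnW.
elim: m => [|m IH] g l y gm gl yl yr.
  by rewrite expr0 mul1r; apply: Gw; rewrite // -gm addn0.
have gt : (mdeg g < t)%N by rewrite -gm -addSnnS leq_addr.
pose Y (p : nat) : 'rV[R]_d := \row_j (if (j < p)%N then y 0 j else 0).
suff step p : (p <= d)%N -> `|G g (Y p)| <= p%:R * (r * ((d%:R * r) ^+ m * w)).
  have -> : y = Y d by apply/rowP => j; rewrite mxE ltn_ord.
  by rewrite exprS -!mulrA; exact: step.
elim: p => [_|p IHp pd].
  have -> : Y 0%N = 0 by apply/rowP => j; rewrite !mxE.
  by rewrite G0 // normr0 mul0r.
pose i := Ordinal pd.
(* The sign of [w] has to be derived: [w] bounds an absolute value as soon as some multi-index of
   degree [t] exists, and the variable [i] provides one. *)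
have w0 : 0 <= (d%:R * r) ^+ m * w.
  case: (leqP i l) => il.
    apply: le_trans (normr_ge0 (G (mi_incr g i) 0)) _; apply: (IH _ i) => [|j ji|j _|j]; rewrite ?mxE ?normr0 //.
    - by rewrite mdeg_incr addSnnS.
    - by rewrite ffunE gl ?(leq_trans ji) // -val_eqE ltn_eqF.
  rewrite mulr_ge0 ?exprn_ge0 ?mulr_ge0 ?ler0n //.
  pose gg : mi d := [ffun j : 'I_d => if j == i then t else 0%N].
  have tt : mdeg gg = t.
    rewrite /mdeg (bigD1 i) //= ffunE eqxx big1 ?addn0 // => j ji.
    by rewrite ffunE (negPf ji).
  apply: le_trans (normr_ge0 (G gg 0)) (Gw _ _ tt _) => j.
  by rewrite mxE normr0.
have IHp' := IHp (ltnW pd).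
have YS : Y p.+1 = Y p + y 0 i *: delta_mx 0 i.
  apply/rowP => j; rewrite !mxE eqxx /= ltnS leq_eqVlt -val_eqE /=.
  case: eqP => [jp|jp] /=; last by rewrite mulr0 addr0.
  by rewrite jp ltnn add0r mulr1; congr (y 0 _); apply/val_inj.
case: (leqP i l) => il; last first.
  rewrite YS yl // scale0r addr0; apply: le_trans IHp' _.
  by apply: ler_wpM2r; [exact: mulr_ge0 | rewrite ler_nat].
have yi := yr i.
have seg z : `|z| <= `|y 0 i| -> forall l, `|(Y p + z *: delta_mx 0 i) 0 l| <= r.
  move=> zy j; rewrite !mxE eqxx /= -val_eqE /=.
  have [->|jp] := eqVneq (val j) p.
    by rewrite ltnn add0r mulr1; apply: le_trans zy _.
  by rewrite mulr0 addr0; case: ifP => _ //; rewrite normr0.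
have [|z zy] := @mean_value_line (G g) (G (mi_incr g i)) (Y p) (delta_mx 0 i) (y 0 i).
  move=> z zy; apply: hG => // [j ji|j]; first by rewrite gl ?(leq_trans ji).
  exact: le_lt_trans (seg z zy j) rrho.
rewrite -YS => /eqP; rewrite subr_eq => /eqP ->.
apply: le_trans (ler_normD _ _) _.
rewrite -natr1 mulrDl mul1r addrC; apply: lerD => //.
rewrite normrM mulrC; apply: ler_pM => //.
apply: (IH _ i) => [|j ji|j ij|]; last exact: seg.
- by rewrite mdeg_incr addSnnS.
- by rewrite ffunE gl ?(leq_trans ji) // -val_eqE ltn_eqF.
- rewrite !mxE eqxx /= -val_eqE /= gtn_eqF // mulr0 addr0.
  by rewrite ltnNge ltnW.
Qed.

(** The derivative of order [g] of the monomial [a]; its falling factorials vanish as soon as some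
    [a l < g l]. *)
Definition mono_deriv a g y : R :=
  \prod_(l < d) ((a l ^_ g l)%:R * y 0 l ^+ (a l - g l)).

Lemma mono_deriv0 a y : mono_deriv a (mi0 d) y = mono a y.
Proof. by apply: eq_bigr => l _; rewrite ffunE ffactn0 subn0 mul1r. Qed.

Lemma mono_deriv_at0 a g : mono_deriv a g 0 = (a == g)%:R * (mfact a)%:R.
Proof.
rewrite /mono_deriv /mfact; case: eqP => [->|ag].
  rewrite mul1r natr_prod; apply: eq_bigr => l _.
  by rewrite subnn expr0 mulr1 ffactnn.
rewrite mul0r.
have [l] : exists l, a l != g l.
  apply/existsP; apply: contra_notT ag; rewrite negb_exists => /forallP h.
  by apply/ffunP => l; apply/eqP; have := h l; rewrite negbK.
rewrite neq_ltn => agl; rewrite (bigD1 l) //= mxE expr0n.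
case/orP: agl => agl; first by rewrite ffact_small // !mul0r.
by rewrite subn_eq0 leqNgt agl mulr0 mul0r.
Qed.

(** Either a falling factorial vanishes or [g <= a] componentwise, and then the degrees force
    [a = g]. *)
Lemma mono_deriv_top a g y : (mdeg a <= mdeg g)%N ->
  mono_deriv a g y = (a == g)%:R * (mfact a)%:R.
Proof.
move=> ag; case: (boolP [exists l, (a l < g l)%N]) => [/existsP[l agl]|].
  rewrite /mono_deriv (bigD1 l) //= ffact_small // mul0r mul0r.
  case: eqP agl => [->|_ _]; rewrite ?ltnn //.
  by rewrite mul0r.
rewrite negb_exists => /forallP h.
have gle l : (g l <= a l)%N by rewrite leqNgt.
have E : g = a.
  apply/ffunP => l; apply/eqP; rewrite eqn_leq gle /=.
  move: ag; rewrite /mdeg (bigD1 l) //= [X in (_ <= X)%N](bigD1 l) //=.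
  have : (\sum_(i | i != l) g i <= \sum_(i | i != l) a i)%N by exact: leq_sum.
  move=> h1 h2.
  rewrite -(leq_add2r (\sum_(i | i != l) a i)); apply: leq_trans h2 _.
  by rewrite leq_add2l.
rewrite -mono_deriv_at0 E; apply: eq_bigr => l _.
by rewrite subnn !expr0.
Qed.

Lemma is_derive_mono_deriv a g (i : 'I_d) y :
  is_derive y (delta_mx 0 i) (mono_deriv a g) (mono_deriv a (mi_incr g i) y).
Proof.
pose C := \prod_(l < d | l != i) ((a l ^_ g l)%:R * y 0 l ^+ (a l - g l)) * (a i ^_ g i)%:R.
have -> : mono_deriv a (mi_incr g i) y = C *: ((a i - g i)%:R *: y 0 i ^+ (a i - g i).-1).
  rewrite /mono_deriv (bigD1 i) //= /C ffunE eqxx addn1 ffactnSr natrM subnS.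
  rewrite [in LHS](eq_bigr (fun l => (a l ^_ g l)%:R * y 0 l ^+ (a l - g l))); last first.
    by move=> l /negPf li; rewrite ffunE li addn0.
  rewrite !scalerAl /=; rewrite [LHS]mulrC -!mulrA; congr (_ * _).
apply: (@is_derive_transfer _ _ (fun z : R => C *: z ^+ (a i - g i)) _ (y 0 i) 1).
  move=> h; rewrite /mono_deriv (bigD1 i) //= !mxE !eqxx mulr1.
  rewrite (eq_bigr (fun l => (a l ^_ g l)%:R * y 0 l ^+ (a l - g l))); last first.
    by move=> l /negPf li; rewrite !mxE li mulr0 add0r.
  by rewrite [h *: 1]mulr1 /GRing.scale /= /C; ring.
set n := (a i - g i)%N.
have -> : (fun z : R => C *: z ^+ n) = C \*: (@id R ^+ n).
  by apply/funext => z; rewrite !fctE.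
apply: is_deriveZ; apply: is_derive_eq.
by rewrite [LHS]mulr1.
Qed.

End Taylor.

(** * Taylor estimates for functionals killing low-degree monomials *)

Section TaylorFunctional.
Variables (R : realType) (d : nat) (H : nat -> seq (mi d)).
Hypothesis Hgr : graded_enum H.
Implicit Types (a b c g : mi d) (y : 'rV[R]_d).

Lemma mem_H s a : (a \in H s) = (mdeg a == s).
Proof. by have [_ ->] := Hgr s. Qed.

Lemma PltS s : Plt H s.+1 = Plt H s ++ H s.
Proof. by rewrite /Plt -[in LHS]addn1 iotaD map_cat flatten_cat /= cats0. Qed.

Lemma mem_Plt s a : (a \in Plt H s) = (mdeg a < s)%N.
Proof.
elim: s => [|s IH]; first by rewrite ltn0.
by rewrite PltS mem_cat IH mem_H ltnS [RHS]leq_eqVlt orbC.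
Qed.

Lemma uniq_Plt s : uniq (Plt H s).
Proof.
elim: s => [//|s IH]; rewrite PltS cat_uniq IH; have [-> _] := Hgr s.
rewrite andbT; apply/hasPn => a; rewrite mem_H => /eqP as_.
by rewrite /= mem_Plt as_ ltnn.
Qed.

Lemma is_derive_sum_seq (V : normedModType R) (T : Type) (s : seq T) (f : T -> V -> R)
    (df : T -> R) x v :
  (forall i, is_derive x v (f i) (df i)) ->
  is_derive x v (fun z => \sum_(i <- s) f i z) (\sum_(i <- s) df i).
Proof.
move=> h; elim: s => [|i s IH].
  rewrite big_nil; have -> : (fun z => \sum_(i <- [::]) f i z) = cst 0.
    by apply/funext => z; rewrite big_nil.
  exact: is_derive_cst.
rewrite big_cons; have -> : (fun z => \sum_(i <- (i :: s)) f i z) =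
    f i + (fun z => \sum_(i <- s) f i z).
  by apply/funext => z; rewrite big_cons fctE.
exact: is_deriveD.
Qed.

Lemma mfact_neq0 a : (mfact a)%:R != 0 :> R.
Proof. by rewrite pnatr_eq0 -lt0n prodn_gt0 // => i; exact: fact_gt0. Qed.

Lemma monoZ a (e : R) y : mono a (e *: y) = e ^+ mdeg a * mono a y.
Proof.
rewrite /mono /mdeg -prodrXr -big_split /=.
by apply: eq_bigr => l _; rewrite mxE exprMn.
Qed.

(** Subtract from [G] a polynomial whose coefficients of degree [t] come from [g], which need not be
    the derivatives at 0; the functional sees only these. The freedom in [g] lets the y-expansion
    start from the leading term of the x-expansion, known up to an error [w]. *)
Lemma taylor_functional t (rho r w e : R) (G : mi d -> 'rV[R]_d -> R) (g : mi d -> R)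
    n (v : 'I_n -> R) (x : 'I_n -> 'rV[R]_d) :
  derivative_family t rho G -> 0 <= e -> 0 <= e * r < rho ->
  (forall i l, `|x i 0 l| <= r) ->
  (forall a, (mdeg a < t)%N -> \sum_i v i * mono a (x i) = 0) ->
  (forall a y, mdeg a = t -> (forall l, `|y 0 l| <= e * r) -> `|G a y - g a| <= w) ->
  `|\sum_i v i * G (mi0 d) (e *: x i) -
    e ^+ t * \sum_(a <- H t) g a / (mfact a)%:R * \sum_i v i * mono a (x i)|
  <= (\sum_i `|v i|) * ((d%:R * (e * r)) ^+ t * w).
Proof.
move=> hG e0 er xr hv hg.
pose c a := (if (mdeg a < t)%N then G a 0 else g a) / (mfact a)%:R.
pose E a0 y := G a0 y - \sum_(a <- Plt H t.+1) c a * mono_deriv a a0 y.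
have famE : derivative_family t rho E.
  move=> a i y ag aj yl; apply: is_deriveB; first exact: hG.
  apply: is_derive_sum_seq => b.
  have -> : (fun y => c b * mono_deriv b a y) = c b \*: (mono_deriv b a).
    by apply/funext.
  by apply: is_deriveZ; exact: is_derive_mono_deriv.
have pick a0 : (mdeg a0 <= t)%N ->
    \sum_(a <- Plt H t.+1) c a * ((a == a0)%:R * (mfact a)%:R) =
    if (mdeg a0 < t)%N then G a0 0 else g a0.
  move=> a0t; rewrite (bigD1_seq a0) ?uniq_Plt ?mem_Plt ?ltnS //= eqxx mul1r.
  rewrite big1 ?addr0; last by move=> a /negPf ->; rewrite mul0r mulr0.
  by rewrite /c divfK // mfact_neq0.
have E0 a0 : (mdeg a0 < t)%N -> E a0 0 = 0.
  move=> a0t; rewrite /E; under eq_bigr do rewrite mono_deriv_at0.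
  by rewrite pick ?(ltnW a0t) // a0t subrr.
have Ew a0 y : mdeg a0 = t -> (forall l, `|y 0 l| <= e * r) -> `|E a0 y| <= w.
  move=> a0t yl; rewrite /E.
  rewrite (eq_big_seq (fun a => c a * ((a == a0)%:R * (mfact a)%:R))); last first.
    by move=> a; rewrite mem_Plt ltnS -a0t => aa0; rewrite mono_deriv_top.
  by rewrite pick ?a0t // ltnn; exact: hg.
have EB i : `|E (mi0 d) (e *: x i)| <= (d%:R * (e * r)) ^+ t * w.
  apply: (derivative_family_bound famE er E0 Ew) => l.
  by rewrite mxE normrM (ger0_norm e0) ler_wpM2l.
have -> : e ^+ t * \sum_(a <- H t) g a / (mfact a)%:R * \sum_i v i * mono a (x i) =
    \sum_i v i * \sum_(a <- Plt H t.+1) c a * mono_deriv a (mi0 d) (e *: x i).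
  under [RHS]eq_bigr do rewrite mulr_sumr.
  rewrite exchange_big /= PltS big_cat /= [X in X + _]big1_seq ?add0r; last first.
    move=> a /andP[_]; rewrite mem_Plt => ain.
    under eq_bigr do rewrite mono_deriv0 monoZ mulrCA (mulrCA _ _ (mono _ _)) mulrA.
    by rewrite -mulr_sumr hv // mulr0.
  rewrite mulr_sumr big_seq [RHS]big_seq; apply: eq_bigr => a; rewrite mem_H => /eqP at_.
  under [RHS]eq_bigr do rewrite mono_deriv0 monoZ mulrCA (mulrCA _ _ (mono _ _)) mulrA.
  by rewrite -mulr_sumr /c at_ ltnn mulrA [e ^+ t * _]mulrC.
rewrite -sumrB; under eq_bigr do rewrite -mulrBr.
apply: le_trans (ler_norm_sum _ _ _) _; rewrite mulr_suml; apply: ler_sum => i _.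
by rewrite normrM ler_wpM2l //; exact: EB.
Qed.

End TaylorFunctional.

(** * Forms of the kernel matrix *)

Section Kernel.
Variables (R : realType) (d : nat) (H : nat -> seq (mi d)).
Hypothesis Hgr : graded_enum H.
Variables (Om : set 'rV[R]_d) (k : nat) (K : 'rV[R]_d * 'rV[R]_d -> R).
Hypotheses (Om_open : open Om) (Om0 : Om 0) (KC : Ckk k.+1 Om K).
Implicit Types (a b c g : mi d) (y z : 'rV[R]_d).

(** [dseq] applies the head of the list last and [dirs] lists the variables in increasing order: a
    new outermost derivative in variable [i] can be added only while no smaller variable occurs. *)
Lemma flatten_nseq_incr (T : Type) (w : 'I_d -> T) a (i : 'I_d) :
  (forall j : 'I_d, (j < i)%N -> a j = 0%N) ->
  flatten [seq nseq (mi_incr a i j) (w j) | j <- enum 'I_d] =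
  w i :: flatten [seq nseq (a j) (w j) | j <- enum 'I_d].
Proof.
move=> ai; have := mem_enum 'I_d i.
have : sorted ltn (map val (enum 'I_d)) by rewrite val_enum_ord iota_ltn_sorted.
rewrite [i \in 'I_d]inE.
elim: (enum 'I_d) => // j s IH /= js.
have jmin := order_path_min ltn_trans js; have ss := path_sorted js.
rewrite inE; have [ij _|ij /= ins] := eqVneq i j.
  rewrite -ij ffunE eqxx addn1 /=; congr (_ :: (_ ++ flatten _)).
  apply/eq_in_map => l ls; rewrite ffunE; case: eqP => [li|]; last by rewrite addn0.
  by have := allP jmin _ (map_f val ls); rewrite li -ij /= ltnn.
have -> : mi_incr a i j = 0%N.
  rewrite ffunE eq_sym (negPf ij) addn0 ai //.
  exact: (allP jmin _ (map_f val ins)).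
rewrite IH // ai //.
exact: (allP jmin _ (map_f val ins)).
Qed.

Lemma flatten_nseq_mi0 (T : Type) (w : 'I_d -> T) (s : seq 'I_d) :
  flatten [seq nseq (mi0 d j) (w j) | j <- s] = [::].
Proof. by elim: s => //= j s ->; rewrite ffunE. Qed.

Lemma Kder00 : Kder K (mi0 d) (mi0 d) = K.
Proof. by rewrite /Kder /dirs !flatten_nseq_mi0. Qed.

Lemma is_derive_Kder_x a b (i : 'I_d) y z : (mdeg a <= k)%N -> (mdeg b <= k.+1)%N ->
  (forall j : 'I_d, (j < i)%N -> a j = 0%N) -> Om y -> Om z ->
  is_derive y (delta_mx 0 i) (fun y => Kder K a b (y, z)) (Kder K (mi_incr a i) b (y, z)).
Proof.
move=> ak bk ai Oy Oz.
have E : dirs R (mi_incr a i) b = ex R i :: dirs R a b.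
  by rewrite /dirs flatten_nseq_incr.
have := @KC (mi_incr a i) b; rewrite mdeg_incr => /(_ ak bk (y, z)).
rewrite E => /(_ _)[|_ der]; first by rewrite inE.
apply: (@is_derive_transfer _ _ _ (Kder K a b) _ (y, z) (ex R i)).
  move=> h; congr (Kder K a b _).
  by rewrite /ex; congr pair; rewrite /= ?scaler0 ?add0r.
by rewrite {2}/Kder E /=; exact: derivableP.
Qed.

(** In [dirs] all x-directions precede the y-directions, so a y-derivative is outermost only at
    x-order zero. This dictates the order of the two expansions in [kernel_form_cvg]. *)
Lemma is_derive_Kder_y b (i : 'I_d) y z : (mdeg b <= k)%N ->
  (forall j : 'I_d, (j < i)%N -> b j = 0%N) -> Om y -> Om z ->
  is_derive z (delta_mx 0 i) (fun z => Kder K (mi0 d) b (y, z))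
    (Kder K (mi0 d) (mi_incr b i) (y, z)).
Proof.
move=> bk bi Oy Oz.
have E : dirs R (mi0 d) (mi_incr b i) = ey R i :: dirs R (mi0 d) b.
  by rewrite /dirs !flatten_nseq_mi0 flatten_nseq_incr.
have m0 : mdeg (mi0 d) = 0%N by rewrite /mdeg big1 // => l _; rewrite ffunE.
have := @KC (mi0 d) (mi_incr b i); rewrite m0 mdeg_incr => /(_ isT bk (y, z)).
rewrite E => /(_ _)[|_ der]; first by rewrite inE.
apply: (@is_derive_transfer _ _ _ (Kder K (mi0 d) b) _ (y, z) (ey R i)).
  move=> h; congr (Kder K (mi0 d) b _).
  by rewrite /ey; congr pair; rewrite /= ?scaler0 ?add0r.
by rewrite {2}/Kder E /=; exact: derivableP.
Qed.

Lemma nbhs00_box (A : set ('rV[R]_d * 'rV[R]_d)) : nbhs (0 : 'rV[R]_d, 0 : 'rV[R]_d) A ->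
  exists2 rho : R, 0 < rho & forall y z, (forall l, `|y 0 l| < rho) ->
    (forall l, `|z 0 l| < rho) -> A (y, z).
Proof.
move=> /nbhs_ballP[rho /= r0 h]; exists rho => // y z yl zl; apply: h.
by split=> /=; split=> // i j; rewrite ord1 -ball_normE /= mxE sub0r normrN.
Qed.

Lemma near_all_seq (T : Type) (I : eqType) (F : set_system T) (FF : Filter F)
    (s : seq I) (P : I -> T -> Prop) :
  (forall i, i \in s -> \forall z \near F, P i z) ->
  \forall z \near F, forall i, i \in s -> P i z.
Proof.
elim: s => [_|i s IH hs]; first by near=> z.
have h1 := hs i (mem_head _ _).
have h2 : \forall z \near F, forall j, j \in s -> P j z.
  by apply: IH => j js; apply: hs; rewrite inE js orbT.
by move: h1 h2; apply: filterS2 => z h1 h2 j; rewrite inE => /predU1P[->//|]; exact: h2.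
Unshelve. all: by end_near. Qed.

Lemma Kder_box (w : R) s t : 0 < w -> (s <= k)%N -> (t <= k)%N ->
  exists2 rho : R, 0 < rho & forall y z, (forall l, `|y 0 l| < rho) ->
    (forall l, `|z 0 l| < rho) -> [/\ Om y, Om z & forall a b, mdeg a = s -> mdeg b = t ->
     `|Kder K a b (y, z) - Kder K a b (0, 0)| <= w].
Proof.
move=> w0 sk tk.
have [|rho r0 h] := @nbhs00_box [set z | [/\ Om z.1, Om z.2 &
    forall a b, mdeg a = s -> mdeg b = t -> `|Kder K a b z - Kder K a b (0, 0)| <= w]];
  last by exists rho.
have nO : nbhs (0 : 'rV[R]_d) Om by apply: open_nbhs_nbhs; split.
have nx : \forall z \near ((0, 0) : 'rV[R]_d * 'rV[R]_d), Om z.1 /\ Om z.2.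
  by exists (Om, Om) => //= -[].
have nK : \forall z \near ((0, 0) : 'rV[R]_d * 'rV[R]_d), forall a, a \in H s ->
    forall b, b \in H t -> `|Kder K a b z - Kder K a b (0, 0)| <= w.
  have : forall a, a \in H s -> forall b, b \in H t ->
    \forall z \near ((0, 0) : 'rV[R]_d * 'rV[R]_d), `|Kder K a b z - Kder K a b (0, 0)| <= w.
    move=> a; rewrite mem_H // => /eqP as_ b; rewrite mem_H // => /eqP bt.
    have [|||cK _] := @KC a b _ _ (0, 0).
    - by rewrite as_ ltnW.
    - by rewrite bt ltnW.
    - by rewrite inE.
    have /cvgrPdist_le /(_ w w0) := cK.
    by apply: filterS => z; rewrite distrC.
  move=> h; have FF := nbhs_filter ((0, 0) : 'rV[R]_d * 'rV[R]_d).
  apply: (near_all_seq FF) => a /h {}h.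
  exact: (near_all_seq FF).
move: nx nK; apply: filterS2 => -[y z] /= [Oy Oz] h; split=> // a b as_ bt.
by apply: h; rewrite mem_H // ?as_ ?bt.
Qed.

Definition wcoef a b : R := Kder K a b (0, 0) / ((mfact a)%:R * (mfact b)%:R).

Lemma kernel_form_cvg n (x : 'I_n -> 'rV[R]_d) (u v : 'I_n -> R) s t :
  (s <= k)%N -> (t <= k)%N ->
  (forall a, (mdeg a < s)%N -> \sum_i u i * mono a (x i) = 0) ->
  (forall b, (mdeg b < t)%N -> \sum_i v i * mono b (x i) = 0) ->
  (\sum_j v j * \sum_i u i * K (e *: x i, e *: x j)) / e ^+ (s + t) @[e --> 0^'+] -->
  \sum_(b <- H t) \sum_(a <- H s)
    (\sum_i u i * mono a (x i)) * wcoef a b * (\sum_i v i * mono b (x i)).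
Proof.
move=> sk tk hu hv; apply/cvgrPdist_le => w w0.
pose r := \sum_i \sum_l `|x i 0 l|.
have xr i l : `|x i 0 l| <= r.
  rewrite /r (bigD1 i) //= (bigD1 l) //= -addrA lerDl addr_ge0 //.
    by apply: sumr_ge0.
  by apply: sumr_ge0 => j _; apply: sumr_ge0.
have r0 : 0 <= r by apply: sumr_ge0 => j _; apply: sumr_ge0.
(* [C] collects the constants of the two successive remainders; the oscillation [om] allowed to the
   derivatives then satisfies [C * om <= w]. *)
pose C := (\sum_i `|v i|) * (d%:R * r) ^+ t * ((\sum_i `|u i|) * (d%:R * r) ^+ s).
have dr0 : 0 <= d%:R * r by rewrite mulr_ge0.
have C0 : 0 <= C by apply: mulr_ge0; apply: mulr_ge0; rewrite ?exprn_ge0 ?sumr_ge0.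
pose om := w / (C + 1).
have om0 : 0 < om by rewrite divr_gt0 // ltr_wpDl.
have [rho rho0 hbox] := Kder_box om0 sk tk.
near=> e.
have e0 : 0 < e by near: e; exact: nbhs_right_gt.
have er : e * r < rho.
  apply: (@le_lt_trans _ _ (e * (r + 1))); first by rewrite ler_pM2l // lerDl.
  rewrite -ltr_pdivlMr ?ltr_wpDl //.
  by near: e; apply: nbhs_right_lt; rewrite divr_gt0 // ltr_wpDl.
have er0 : 0 <= e * r by rewrite mulr_ge0 // ltW.
have ex_ i l : `|(e *: x i) 0 l| <= e * r.
  by rewrite mxE normrM gtr0_norm // ler_pM2l.
have box0 l : `|(0 : 'rV[R]_d) 0 l| < rho by rewrite mxE normr0.
have boxx i l : `|(e *: x i) 0 l| < rho by exact: le_lt_trans er.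
pose U a := \sum_i u i * mono a (x i).
(* The leading part of the x-expansion, with derivatives frozen at (0, 0); it serves as the
   top-degree data of the y-expansion. *)
pose g b := e ^+ s * \sum_(a <- H s) Kder K a b (0, 0) / (mfact a)%:R * U a.
pose w' := (\sum_i `|u i|) * ((d%:R * (e * r)) ^+ s * om).
have first_step b y : mdeg b = t -> (forall l, `|y 0 l| <= e * r) ->
    `|\sum_i u i * Kder K (mi0 d) b (e *: x i, y) - g b| <= w'.
  move=> bt yl; have ylt l : `|y 0 l| < rho by exact: le_lt_trans er.
  apply: (@taylor_functional _ _ _ Hgr s rho r om e
     (fun a z => Kder K a b (z, y)) (fun a => Kder K a b (0, 0)) _ u x) => //.
  - move=> a i z as_ aj zl; have [Oz Oy _] := hbox z y zl ylt.
    apply: is_derive_Kder_x => //; last by rewrite bt ltnW.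
    exact: leq_trans (ltnW as_) sk.
  - by rewrite ?er0 ?ltW.
  - move=> a z as_ zl; have [_ _] := hbox z y (fun l => le_lt_trans (zl l) er) ylt.
    exact.
have := @taylor_functional _ _ _ Hgr t rho r w' e
     (fun b y => \sum_i u i * Kder K (mi0 d) b (e *: x i, y)) g _ v x.
rewrite er0 er (ltW e0) Kder00 => /(_ _ isT isT xr hv first_step) main.
have {}main := main _.
set L := (X in X / _).
set S := (X in `|X - _|).
have -> : S - L / e ^+ (s + t) = - ((L - e ^+ (s + t) * S) / e ^+ (s + t)).
  rewrite mulrBl -[e ^+ (s + t) * S]mulrC mulfK ?opprB //.
  by rewrite expf_neq0 // gt_eqF.
rewrite normrN normrM normfV (gtr0_norm (exprn_gt0 _ e0)) ler_pdivrMr ?exprn_gt0 //.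
have -> : e ^+ (s + t) * S =
   e ^+ t * (\sum_(a <- H t) g a / (mfact a)%:R * (\sum_i v i * mono a (x i))).
  rewrite exprD /S [e ^+ s * _]mulrC -mulrA; congr (_ * _).
  rewrite mulr_sumr; apply: eq_bigr => b _.
  rewrite /g -!mulrA; congr (_ * _); rewrite mulr_suml; apply: eq_bigr => a _.
  by rewrite /wcoef /U invfM; ring.
apply: le_trans (main _) _.
  move=> b i z bt bj zl.
  apply: is_derive_sum_seq => j.
  have [Ox Oz _] := hbox (e *: x j) z (boxx j) zl.
  have -> : (fun y => u j * Kder K (mi0 d) b (e *: x j, y)) =
     u j \*: (fun y => Kder K (mi0 d) b (e *: x j, y)) by apply/funext.
  by apply: is_deriveZ; apply: is_derive_Kder_y => //; exact: leq_trans (ltnW bt) tk.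
have -> : (\sum_i `|v i|) * ((d%:R * (e * r)) ^+ t * w') = e ^+ (s + t) * (C * om).
  by rewrite /w' /C !(mulrCA d%:R e) ![(e * _) ^+ _]exprMn exprD; ring.
rewrite mulrC ler_pM2r ?exprn_gt0 // /om mulrCA ger_pMr // ler_pdivrMr ?mul1r.
  by rewrite lerDl.
by rewrite ltr_wpDl.
Unshelve. all: by end_near. Qed.

End Kernel.

(** * Orthogonal rank-one projectors *)

Section Projectors.
Variables (R : realType) (n : nat) (P : 'I_n -> 'M[R]_n).

Lemma rank1_factor (A : 'M[R]_n) : \rank A = 1%N ->
  exists (c : 'cV[R]_n) (r : 'rV[R]_n), A = c *m r.
Proof.
move=> rA; move: (col_base A) (row_base A) (mulmx_base A); rewrite rA => c r <-.
by exists c, r.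
Qed.

Hypothesis PP : forall i j, P i *m P j = (if i == j then P i else 0).
Hypothesis P1 : forall i, \rank (P i) = 1%N.

(** With [P i = c i *m r i], the product [P i *m P j] is the scalar [r i *m c j] times the nonzero
    matrix [c i *m r j]. The relations thus say that the [r i] are dual to the [c j], and [n] such
    pairs form two inverse square matrices. *)
Lemma projectors_diagonalization : exists C D : 'M[R]_n, [/\ D *m C = 1%:M, C *m D = 1%:M &
  forall mu : 'I_n -> R, \sum_i mu i *: P i = C *m diag_mx (\row_i mu i) *m D].
Proof.
have /choice[c hc] : forall i, exists c : 'cV[R]_n, exists r : 'rV[R]_n, P i = c *m r.
  by move=> i; exact: rank1_factor.
have {hc} /choice[r hr] : forall i, exists r : 'rV[R]_n, P i = c i *m r by [].
pose C := \matrix_(a, i) c i a 0; pose D := \matrix_(i, a) r i 0 a.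
have DCE i j : (D *m C) i j = (r i *m c j) 0 0.
  by rewrite !mxE; apply: eq_bigr => l _; rewrite !mxE.
have PE i j : P i *m P j = ((r i *m c j) 0 0) *: (c i *m r j).
  rewrite !hr mulmxA -(mulmxA (c i)) [r i *m c j]mx11_scalar mul_mx_scalar.
  by rewrite -scalemxAl !mxE eqxx mulr1n.
have nz i j : c i *m r j != 0.
  apply/eqP => cr0.
  have := P1 i; rewrite hr; case: (eqVneq (c i) 0) => [->|ci].
    by rewrite mul0mx mxrank0.
  have rj : r j != 0.
    by apply/eqP => rj; have := P1 j; rewrite hr rj mulmx0 mxrank0.
  have [a ca] : exists a, c i a 0 != 0.
    apply/existsP; apply: contra_neqT ci; rewrite negb_exists => /forallP h.
    by apply/colP => a; rewrite mxE; apply/eqP; have := h a; rewrite negbK.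
  have [b rb] : exists b, r j 0 b != 0.
    apply/existsP; apply: contra_neqT rj; rewrite negb_exists => /forallP h.
    by apply/rowP => b; rewrite mxE; apply/eqP; have := h b; rewrite negbK.
  move/matrixP: cr0 => /(_ a b); rewrite !mxE big_ord1 => /eqP.
  by rewrite mulf_eq0 (negPf ca) (negPf rb).
have DC : D *m C = 1%:M.
  apply/matrixP => i j; rewrite DCE [RHS]mxE; have := PE i j; rewrite PP.
  case: eqP => [->|ij] /eqP; rewrite ?hr -subr_eq0.
    rewrite -{1}[c j *m r j]scale1r -scalerBl scaler_eq0 (negPf (nz _ _)) orbF.
    by rewrite subr_eq0 => /eqP <-.
  by rewrite sub0r oppr_eq0 scaler_eq0 (negPf (nz _ _)) orbF => /eqP.
exists C, D; split=> //; first exact: mulmx1C.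
move=> mu; apply/matrixP => a b; rewrite mul_mx_diag summxE !mxE.
by apply: eq_bigr => i _; rewrite !mxE hr !mxE big_ord1; ring.
Qed.

Lemma sum_projectors : \sum_i P i = 1%:M.
Proof.
have [C [D [_ CD h]]] := projectors_diagonalization.
have := h (fun=> 1); under eq_bigr do rewrite scale1r.
move=> ->; rewrite -[RHS]CD; congr (_ *m _).
by apply/matrixP => i j; rewrite mul_mx_diag !mxE mulr1.
Qed.

Lemma det_sum_projectors (mu : 'I_n -> R) : \det (\sum_i mu i *: P i) = \prod_i mu i.
Proof.
have [C [D [_ CD ->]]] := projectors_diagonalization.
rewrite !det_mulmx mulrAC -det_mulmx CD det1 mul1r det_diag.
by apply: eq_bigr => i _; rewrite mxE.
Qed.

Lemma mxtrace_sum_projectors (mu : 'I_n -> R) : \tr (\sum_i mu i *: P i) = \sum_i mu i.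
Proof.
have [C [D [DC _ ->]]] := projectors_diagonalization.
rewrite mxtrace_mulC mulmxA DC mul1mx mxtrace_diag.
by apply: eq_bigr => i _; rewrite mxE.
Qed.

Hypothesis PT : forall i, (P i)^T = P i.

Lemma form_projector (u : 'cV[R]_n) i : (u^T *m P i *m u) 0 0 = \sum_a (P i *m u) a 0 ^+ 2.
Proof.
have -> : u^T *m P i *m u = (P i *m u)^T *m (P i *m u).
  by rewrite trmx_mul PT mulmxA -[X in _ = X *m u]mulmxA PP eqxx.
by rewrite mxE; apply: eq_bigr => a _; rewrite mxE expr2.
Qed.

Lemma form_projector_ge0 (u : 'cV[R]_n) i : 0 <= (u^T *m P i *m u) 0 0.
Proof. by rewrite form_projector; apply: sumr_ge0 => a _; exact: sqr_ge0. Qed.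

Lemma form_sum_projectors (u : 'cV[R]_n) mu :
  (u^T *m (\sum_i mu i *: P i) *m u) 0 0 = \sum_i mu i * (u^T *m P i *m u) 0 0.
Proof.
rewrite mulmx_sumr mulmx_suml summxE; apply: eq_bigr => i _.
by rewrite -scalemxAr -scalemxAl mxE.
Qed.

Lemma norm2_projectors (u : 'cV[R]_n) :
  \sum_a u a 0 ^+ 2 = \sum_i (u^T *m P i *m u) 0 0.
Proof.
have := form_sum_projectors u (fun=> 1).
under eq_bigr do rewrite scale1r; rewrite sum_projectors mulmx1.
under [in RHS]eq_bigr do rewrite mul1r; move=> <-.
by rewrite mxE; apply: eq_bigr => a _; rewrite mxE expr2.
Qed.

(** Test the form on a nonzero column of [P i]: all the other projectors kill it. *)
Lemma psd_eigenvalue_ge0 mu : psdmx (\sum_i mu i *: P i) -> forall i, 0 <= mu i.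
Proof.
move=> psd i.
have [j Pj] : exists j, col j (P i) != 0.
  apply/existsP/contraT; rewrite negb_exists => /forallP h.
  suff Pi0 : P i = 0 by have := P1 i; rewrite Pi0 mxrank0.
  apply/matrixP => a j; have := h j; rewrite negbK => /eqP/matrixP/(_ a 0).
  by rewrite !mxE.
have colm l : P l *m col j (P i) = col j (P l *m P i) by rewrite !colE mulmxA.
have := psd (col j (P i)); rewrite form_sum_projectors (bigD1 i) //= big1 => [|l li].
  rewrite addr0; set q := _ 0 0; suff q0 : 0 < q by rewrite pmulr_lge0.
  rewrite lt_neqAle form_projector_ge0 andbT /q form_projector eq_sym.
  rewrite colm PP eqxx psumr_eq0 => [|a _]; last exact: sqr_ge0.
  apply: contra Pj => /allP h; apply/eqP/colP => a; rewrite [RHS]mxE.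
  by apply/eqP; rewrite -sqrf_eq0; apply: (h a); rewrite mem_index_enum.
rewrite form_projector colm PP (negPf li) big1 ?mulr0 // => a _.
by rewrite !mxE expr0n.
Qed.

(* Courant-Fischer: the first [i+1] eigenspaces meet the kernel of [V]. *)
Lemma eigenvalue_le (mu : 'I_n -> R) m (V : 'M[R]_(n, m)) (B : R) (i : 'I_n) :
  (forall j, 0 <= mu j) -> (forall j : 'I_n, (j <= i)%N -> mu i <= mu j) ->
  (\rank V <= i)%N ->
  (forall u : 'cV[R]_n, u^T *m V = 0 ->
     (u^T *m (\sum_j mu j *: P j) *m u) 0 0 <= B * \sum_a u a 0 ^+ 2) ->
  mu i <= B.
Proof.
move=> mu0 mui rV hB.
have [C [D [DC CD PE]]] := projectors_diagonalization.
have CjE j : P j *m C = C *m delta_mx j j.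
  have := PE (fun l => (l == j)%:R); rewrite (bigD1 j) //= eqxx scale1r.
  rewrite big1 ?addr0 => [->|l /negPf ->]; last by rewrite scale0r.
  rewrite -!mulmxA DC mulmx1; congr (_ *m _); apply/matrixP => a b; rewrite !mxE.
  by case: (eqVneq a b) => [->|ab]; rewrite ?mulr1n ?mulr0n ?andbb //;
    case: (eqVneq a j) => //= aj; rewrite -aj eq_sym (negPf ab).
pose Y : 'M[R]_(i.+1, n) := \matrix_(a, b) C b (widen_ord (ltn_ord i) a).
have Yfree : row_free Y.
  apply/row_freeP; exists (\matrix_(b, a) D (widen_ord (ltn_ord i) a) b).
  apply/matrixP => a b; rewrite mxE.
  have := congr1 (fun M : 'M[R]_n => M (widen_ord (ltn_ord i) b) (widen_ord (ltn_ord i) a)) DC.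
  rewrite /= [in RHS]mxE [in X in X = _]mxE => DCab.
  rewrite [RHS]mxE eq_sym -(inj_eq (f := widen_ord (ltn_ord i))); last first.
    by move=> a' b' /(congr1 val) /= h; apply/val_inj.
  by rewrite -DCab; apply: eq_bigr => l _; rewrite !mxE mulrC.
(* The [i + 1] vectors meet at most [i] independent conditions, [V] having rank at most [i]. *)
have [w w0 wV] : exists2 w : 'rV[R]_(i.+1), w != 0 & w *m (Y *m V) = 0.
  have : kermx (Y *m V) != 0.
    rewrite -mxrank_eq0 mxrank_ker subn_eq0 -ltnNge ltnS.
    by apply: leq_trans rV; exact: mxrankM_maxr.
  case/rowV0Pn => w /sub_kermxP wV w0; by exists w.
pose u := (w *m Y)^T.
have uV : u^T *m V = 0 by rewrite trmxK -mulmxA.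
have u0 : u != 0.
  rewrite /u trmx_eq0; apply: contra w0 => /eqP wY.
  by apply/eqP/(row_free_inj Yfree); rewrite /= wY mul0mx.
have uC : u = C *m \col_a (if insub (val a) is Some b then w 0 b else 0).
  apply/colP => a; rewrite !mxE.
  rewrite (bigID (fun j : 'I_n => (j < i.+1)%N)) /= [X in _ = _ + X]big1 ?addr0.
    rewrite (big_ord_narrow (ltn_ord i)) /=; apply: eq_bigr => b _.
    rewrite !mxE mulrC; congr (_ * _).
    by rewrite insubT //= => h; congr (w 0 _); apply/val_inj.
  by move=> j ji; rewrite mxE insubN // mulr0.
have Pju (j : 'I_n) : (i < j)%N -> P j *m u = 0.
  move=> ij; rewrite uC mulmxA CjE -mulmxA.
  suff -> : delta_mx j j *m (\col_a (if insub (val a) is Some b then w 0 b else 0)) = 0 :> 'cV[R]_n.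
    by rewrite mulmx0.
  apply/colP => a; rewrite !mxE big1 // => b _; rewrite !mxE.
  case: (eqVneq b j) => [->|]; last by rewrite andbF mul0r.
  by rewrite insubN ?mulr0 // ltnS -ltnNge.
have N0 : 0 < \sum_a u a 0 ^+ 2.
  rewrite lt_neqAle sumr_ge0 => [|a _]; last exact: sqr_ge0.
  rewrite andbT eq_sym psumr_eq0 => [|a _]; last exact: sqr_ge0.
  apply: contra u0 => /allP h; apply/eqP/colP => a; rewrite [RHS]mxE.
  by apply/eqP; rewrite -sqrf_eq0; apply: (h a); rewrite mem_index_enum.
rewrite -(ler_pM2r N0); apply: le_trans (hB u uV).
rewrite form_sum_projectors norm2_projectors mulr_sumr; apply: ler_sum => j _.
case: (leqP j i) => ji; first by rewrite ler_wpM2r ?form_projector_ge0 // mui.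
by rewrite form_projector Pju // big1 ?mulr0 // => a _; rewrite mxE expr0n.
Qed.

End Projectors.

(** * One-sided limits *)

Section Limits.
Variable R : realType.

Lemma cvg_pow0 N : (e ^+ N : R) @[e --> (0 : R)^'+] --> ((N == 0%N)%:R : R).
Proof.
have c : (e ^+ N : R) @[e --> (0 : R)] --> (0 ^+ N : R) by exact: exprn_continuous.
by rewrite -expr0n; apply: cvg_within_filter c.
Qed.

Lemma near_right_eq_cvg (f g : R -> R) (l : R) : (forall e, 0 < e -> f e = g e) ->
  f e @[e --> 0^'+] --> l -> g e @[e --> 0^'+] --> l.
Proof.
move=> fg; apply: cvg_trans; apply: near_eq_cvg; near=> e.
by apply: fg; near: e; exact: nbhs_right_gt.
Unshelve. all: by end_near. Qed.

Lemma cvg_div_lower_pow (f : R -> R) N M (l : R) : (N <= M)%N ->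
  f e / e ^+ M @[e --> 0^'+] --> l ->
  f e / e ^+ N @[e --> 0^'+] --> (N == M)%:R * l.
Proof.
move=> NM cv.
have -> : (N == M)%:R * l = ((M - N)%N == 0%N)%:R * l.
  by rewrite subn_eq0 eqn_leq NM.
apply: near_right_eq_cvg (cvgM (@cvg_pow0 (M - N)) cv) => e e0.
have ep p : e ^+ p != 0 by rewrite expf_neq0 // gt_eqF.
rewrite mulrCA; congr (_ * _).
by rewrite -{2}(subnK NM) exprD invfM mulrA divff ?mul1r.
Qed.

Lemma cvg_det n (F : R -> 'M[R]_n) (L : 'M[R]_n) :
  (forall i j, F e i j @[e --> 0^'+] --> L i j) -> \det (F e) @[e --> 0^'+] --> \det L.
Proof.
move=> h; rewrite /determinant.
apply: cvg_big => [|s _]; first exact: add_continuous.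
apply: cvgM; first exact: cvg_cst.
by apply: cvg_big => [|i _]; [exact: mul_continuous | exact: h].
Qed.

Lemma cvg_prod_fin n (F : 'I_n -> R -> R) (L : 'I_n -> R) :
  (forall i, F i e @[e --> 0^'+] --> L i) ->
  \prod_i F i e @[e --> 0^'+] --> \prod_i L i.
Proof. by move=> h; apply: cvg_big => [|i _]; [exact: mul_continuous | exact: h]. Qed.

(** In [det_limit], [B] has [m + m'] columns, a number equal to [n] only up to a proof;
    [\det (B^T *m B)] stands for the square of its determinant. *)
Lemma det_congruence n q (E : q = n) (B : 'M[R]_(n, q)) (X : 'M[R]_n) :
  \det (B^T *m X *m B) = \det (B^T *m B) * \det X.
Proof. by case: n / E B X => B X; rewrite !det_mulmx; ring. Qed.

Lemma det_scale q (M : 'M[R]_q) (u v : 'I_q -> R) :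
  \det (\matrix_(a, b) (u a * M a b * v b)) = \det M * \prod_a (u a * v a).
Proof.
have -> : \matrix_(a, b) (u a * M a b * v b) =
    diag_mx (\row_a u a) *m M *m diag_mx (\row_a v a).
  by apply/matrixP => a b; rewrite mul_mx_diag mul_diag_mx !mxE.
rewrite !det_mulmx !det_diag big_split /= mulrAC mulrC; congr (_ * (_ * _));
  by apply: eq_bigr => a _; rewrite mxE.
Qed.

(** If [w] kills the Gram matrix, [w *m V^T] has zero Euclidean norm, hence vanishes. *)
Lemma row_free_gram_unit n m (V : 'M[R]_(n, m)) : \rank V = m -> V^T *m V \in unitmx.
Proof.
move=> rV; have VTf : row_free V^T by rewrite /row_free mxrank_tr rV.
rewrite -row_free_unit -kermx_eq0; apply/rowV0P => w /sub_kermxP.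
rewrite mulmxA => wVV; apply: (row_free_inj VTf); rewrite /= mul0mx.
have : (w *m V^T) *m (w *m V^T)^T = 0 by rewrite trmx_mul trmxK mulmxA wVV mul0mx.
move: (w *m V^T) => u /matrixP /(_ 0 0); rewrite [LHS]mxE [RHS]mxE => /eqP.
rewrite psumr_eq0 => [|a _]; last by rewrite mxE -expr2 sqr_ge0.
move=> /allP h; apply/rowP => a; rewrite [RHS]mxE; apply/eqP.
have := h a; rewrite mem_index_enum => /(_ isT); by rewrite mxE -expr2 sqrf_eq0.
Qed.

End Limits.

(** * Determinant and polynomial identities *)

Section Algebra.

Lemma det_schur (R : comUnitRingType) m1 m2 (A : 'M[R]_m1) B C (D : 'M[R]_m2) : A \in unitmx ->
  \det (block_mx A B C D) = \det A * \det (D - C *m invmx A *m B).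
Proof.
move=> Au; have -> : \det A * \det (D - C *m invmx A *m B) =
    \det (block_mx A B 0 (D - C *m invmx A *m B)) by rewrite det_ublock.
have -> : block_mx A B C D =
    block_mx 1%:M 0 (C *m invmx A) 1%:M *m block_mx A B 0 (D - C *m invmx A *m B).
  by rewrite mulmx_block !mul1mx !mul0mx !addr0 mulmxKV // [C *m _ *m B + _]addrC subrK.
by rewrite det_mulmx det_lblock !det1 !mul1r.
Qed.

Lemma prod_const_ge (R : comNzRingType) n (z : R) (c : nat) : \prod_(i < n | (c <= i)%N) z = z ^+ (n - c).
Proof.
by rewrite -prodr_const_nat big_geq_mkord.
Qed.

Lemma char_poly_horner (R : comNzRingType) m (A : 'M[R]_m) z : (char_poly A).[z] = \det (z%:M - A).
Proof.
rewrite /char_poly -horner_evalE -det_map_mx; congr (\det _).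
apply/matrixP => i j; rewrite !mxE /= horner_evalE hornerD hornerN hornerC.
by case: eqP => _; rewrite ?mulr1n ?mulr0n ?hornerX ?hornerC.
Qed.

(** In characteristic zero the naturals supply more roots of the difference than its degree
    allows. *)
Lemma poly_ext (R : numDomainType) (p1 p2 : {poly R}) : (forall z, p1.[z] = p2.[z]) -> p1 = p2.
Proof.
move=> h; apply/eqP; rewrite -subr_eq0; apply/negPn/negP => nz.
pose rs := [seq (i%:R : R) | i <- iota 0 (size (p1 - p2))].
suff : (size rs < size (p1 - p2)%R)%N by rewrite size_map size_iota ltnn.
apply: max_poly_roots => //.
  by apply/allP => z _; rewrite rootE hornerD hornerN h subrr.
by rewrite map_inj_uniq ?iota_uniq // => i j /eqP; rewrite eqr_nat => /eqP.
Qed.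

Lemma colblockE (R : realType) m n (A : 'M[R]_(m, n)) lo N i (j : 'I_N) (h : (lo + j < n)%N) :
  colblock A lo N i j = A i (Ordinal h).
Proof. by rewrite mxE (big_pred1 (Ordinal h)). Qed.

End Algebra.

(** * Column blocks and orthogonal matrices *)

Section Blocks.
Variables (R : realType) (n : nat).

(** Taking a block is multiplication by a 0-1 matrix [S]; the zeros of [M] say exactly that [M *m S]
    factors through [S]. *)
Lemma colblock_sub (A B M : 'M[R]_n) lo N : (lo + N <= n)%N -> A = B *m M ->
  (forall l i : 'I_n, (lo <= i < lo + N)%N -> ~~ (lo <= l < lo + N)%N -> M l i = 0) ->
  ((colblock A lo N)^T <= (colblock B lo N)^T)%MS.
Proof.
move=> loN AE M0; pose S : 'M[R]_(n, N) := \matrix_(l, j) (val l == lo + j)%N%:R.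
have colS (X : 'M[R]_n) : colblock X lo N = X *m S.
  apply/matrixP => i j; rewrite !mxE big_mkcond; apply: eq_bigr => l _.
  by rewrite mxE; case: eqP; rewrite ?mulr1 ?mulr0.
suff MS : M *m S = S *m (S^T *m M *m S).
  apply/submxP; exists (S^T *m M *m S)^T.
  by rewrite -trmx_mul !colS AE -mulmxA MS mulmxA.
apply/matrixP => l j.
have hj : (lo + j < n)%N by apply: leq_trans loN; rewrite ltn_add2l.
have [/andP[lol llo]|lblk] := boolP (lo <= l < lo + N)%N; last first.
  rewrite -colS (colblockE _ _ hj) M0 //=; last by rewrite leq_addr ltn_add2l ltn_ord.
  rewrite mxE big1 // => j' _; rewrite mxE; case: eqP => [lE|_]; last by rewrite mul0r.
  by case/negP: lblk; rewrite lE leq_addr ltn_add2l ltn_ord.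
have l'N : (l - lo < N)%N by rewrite ltn_subLR.
rewrite [RHS]mxE (bigD1 (Ordinal l'N)) //= big1 ?addr0 => [|j' j'l]; last first.
  rewrite mxE; case: eqP => [lE|_]; last by rewrite mul0r.
  by case/eqP: j'l; apply/val_inj; rewrite /= lE addKn.
rewrite [S l _]mxE /= subnKC // eqxx mul1r -mulmxA [RHS]mxE (bigD1 l) //= big1 ?addr0.
  by rewrite [S^T _ _]mxE [S l _]mxE /= subnKC // eqxx mul1r.
move=> l2 l2l; rewrite [S^T _ _]mxE [S l2 _]mxE /= subnKC //.
by rewrite val_eqE (negPf l2l) mul0r.
Qed.

(** The first [m] rows have all their squared norm in the upper left block, which therefore exhausts
    that of the first [m] columns; nothing is left below it. *)
Lemma orthogonal_block (T : 'M[R]_n) m : T *m T^T = 1%:M -> T^T *m T = 1%:M ->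
  (forall i j : 'I_n, (i < m)%N -> (m <= j)%N -> T i j = 0) ->
  forall i j : 'I_n, (m <= i)%N -> (j < m)%N -> T i j = 0.
Proof.
move=> TT' T'T T0.
have rowT i : \sum_j T i j ^+ 2 = 1.
  have := congr1 (fun X : 'M[R]_n => X i i) TT'; rewrite !mxE eqxx mulr1n => <-.
  by apply: eq_bigr => j _; rewrite mxE expr2.
have colT j : \sum_i T i j ^+ 2 = 1.
  have := congr1 (fun X : 'M[R]_n => X j j) T'T; rewrite !mxE eqxx mulr1n => <-.
  by apply: eq_bigr => i _; rewrite mxE expr2.
have S1 : \sum_(i < n | (i < m)%N) \sum_(j < n | (j < m)%N) T i j ^+ 2 =
    \sum_(i < n | (i < m)%N) 1.
  apply: eq_bigr => i im; rewrite -(rowT i) [RHS](bigID (fun j : 'I_n => (j < m)%N)) /=.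
  by rewrite [X in _ + X]big1 ?addr0 // => j; rewrite -leqNgt => mj; rewrite T0 // expr0n.
have S2 : \sum_(j < n | (j < m)%N) \sum_(i < n | ~~ (i < m)%N) T i j ^+ 2 = 0.
  have : \sum_(j < n | (j < m)%N) \sum_(i < n) T i j ^+ 2 = \sum_(i < n | (i < m)%N) 1.
    by apply: eq_bigr => j _; exact: colT.
  under eq_bigr do rewrite (bigID (fun i : 'I_n => (i < m)%N)) /=.
  rewrite big_split /= exchange_big /= S1 => /eqP.
  by rewrite -subr_eq0 addrAC subrr add0r => /eqP.
move=> i j mi jm.
have h1 := psumr_eq0P _ S2; have {}h1 := h1 _ j jm.
apply/eqP; rewrite -sqrf_eq0; apply/eqP.
have h2 : \sum_(i < n | ~~ (i < m)%N) T i j ^+ 2 = 0.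
  by apply: h1 => j' _; apply: sumr_ge0 => ? _; exact: sqr_ge0.
have h3 := psumr_eq0P _ h2; apply: h3; last by rewrite -leqNgt.
by move=> ? _; exact: sqr_ge0.
Qed.

End Blocks.

(** * Eigenvalues and limiting eigenvectors *)

Section Multiindices.
Variables (d : nat) (H : nat -> seq (mi d)).
Hypothesis Hgr : graded_enum H.

Lemma Plt_cat s t : (s <= t)%N -> exists r, Plt H t = Plt H s ++ r.
Proof.
move=> /subnK <-; elim: (t - s)%N => [|p [r IH]]; first by exists [::]; rewrite cats0.
by exists (r ++ H (p + s)%N); rewrite addSn PltS IH catA.
Qed.

Lemma size_Plt_mono s t : (s <= t)%N -> (size (Plt H s) <= size (Plt H t))%N.
Proof. by move=> /Plt_cat[r ->]; rewrite size_cat leq_addr. Qed.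

Lemma lt_size_Plt s t i : (i < size (Plt H t))%N ->
  (i < size (Plt H s))%N = (mdeg (nth (mi0 d) (Plt H t) i) < s)%N.
Proof.
move=> it; case: (leqP s t) => st; last first.
  rewrite (leq_trans it) ?(size_Plt_mono (ltnW st)) //.
  by rewrite (ltn_trans _ st) // -(mem_Plt Hgr) mem_nth.
have [r E] := Plt_cat st; have := uniq_Plt Hgr t; move: it; rewrite E.
rewrite cat_uniq size_cat nth_cat => it /and3P[_ /hasPn hr _].
case: ltnP => si; first by rewrite -(mem_Plt Hgr) mem_nth.
rewrite -(mem_Plt Hgr); apply/esym/negbTE/hr.
by rewrite mem_nth // ltn_subLR.
Qed.

Lemma nth_Plt s t i : (i < size (Plt H s))%N -> (s <= t)%N ->
  nth (mi0 d) (Plt H t) i = nth (mi0 d) (Plt H s) i.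
Proof. by move=> is_ /Plt_cat[r ->]; rewrite nth_cat is_. Qed.

Lemma size_Plt1 : size (Plt H 1) = 1%N.
Proof.
rewrite (@perm_size _ _ [:: mi0 d]) //; apply: uniq_perm => [|//|a].
  exact: uniq_Plt.
rewrite mem_Plt // inE ltnS leqn0 /mdeg sum_nat_eq0; apply/forallP/eqP => [h|-> i].
  by apply/ffunP => i; rewrite ffunE; apply/eqP; exact: h.
by rewrite ffunE.
Qed.

End Multiindices.

Section Eigenvalues.
Variables (R : realType) (d : nat) (H : nat -> seq (mi d))
  (Om : set 'rV[R]_d) (k n : nat) (K : 'rV[R]_d * 'rV[R]_d -> R)
  (x : 'I_n -> 'rV[R]_d) (e0 : R).
Hypothesis Hgr : graded_enum H.
Hypotheses (Om_open : open Om) (Om0 : Om 0) (KC : Ckk k.+1 Om K).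
Hypothesis hn : (size (Plt H k) < n <= size (Plt H k.+1))%N.
Hypothesis e0_gt0 : 0 < e0.
Hypothesis Kpsd : forall e : R, 0 <= e <= e0 ->
  (Keps K x e)^T = Keps K x e /\ psdmx (Keps K x e).
Variables (lam : 'I_n -> R -> R) (P : 'I_n -> R -> 'M[R]_n)
  (p : 'I_n -> 'cV[R]_n) (del : R).
Hypothesis del_gt0 : 0 < del.
Hypothesis lamP_analytic : forall i, analytic0 (lam i) /\ mx_analytic0 (P i).
Hypothesis spectral : forall e : R, 0 <= e < del ->
  Keps K x e = \sum_(i < n) lam i e *: P i e /\
     (forall i j : 'I_n, (P i e)^T = P i e /\
        P i e *m P j e = (if i == j then P i e else 0) /\
        \rank (P i e) = 1%N).
Hypothesis lam_sorted : forall e : R, 0 < e < del ->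
     forall i j : 'I_n, (i <= j)%N -> lam j e <= lam i e.

Let KE e : 0 <= e < del -> Keps K x e = \sum_(i < n) lam i e *: P i e.
Proof. by move=> /spectral[]. Qed.
Let PP e : 0 <= e < del -> forall i j, P i e *m P j e = if i == j then P i e else 0.
Proof. by move=> /spectral[_ h] i j; have [_ []] := h i j. Qed.
Let PT e : 0 <= e < del -> forall i, (P i e)^T = P i e.
Proof. by move=> /spectral[_ h] i; have [] := h i i. Qed.
Let P1 e : 0 <= e < del -> forall i, \rank (P i e) = 1%N.
Proof. by move=> /spectral[_ h] i; have [_ []] := h i i. Qed.

(** The group of the i-th eigenvalue, read off the graded enumeration; this also fits the truncated
    last group. *)
Definition idx_deg (i : 'I_n) : nat := mdeg (nth (mi0 d) (Plt H k.+1) i).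

Lemma idx_degP (i : 'I_n) s : (i < size (Plt H s))%N = (idx_deg i < s)%N.
Proof.
apply: lt_size_Plt => //; case/andP: hn => _; exact: leq_trans.
Qed.

Lemma idx_deg_le (i : 'I_n) : (idx_deg i <= k)%N.
Proof. by rewrite -ltnS -idx_degP; case/andP: hn => _; exact: leq_trans. Qed.

Lemma grpE s (i : 'I_n) : grp H s i = (idx_deg i == s).
Proof. by rewrite /grp idx_degP leqNgt idx_degP -leqNgt ltnS eqn_leq andbC. Qed.

Definition kform (u v : 'I_n -> R) e : R :=
  \sum_j v j * \sum_i u i * K (e *: x i, e *: x j).

Lemma kformE q r (A : 'M[R]_(n, q)) (B : 'M[R]_(n, r)) e a b :
  (A^T *m Keps K x e *m B) a b = kform (A^~ a) (B^~ b) e.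
Proof.
rewrite mxE /kform; apply: eq_bigr => j _; rewrite mulrC; congr (_ * _).
by rewrite mxE; apply: eq_bigr => i _; rewrite !mxE.
Qed.

Lemma kills_Vmx q (A : 'M[R]_(n, q)) s (b : 'I_q) : row b (A^T *m Vmx x (Plt H s)) = 0 ->
  forall a, (mdeg a < s)%N -> \sum_i A i b * mono a (x i) = 0.
Proof.
move=> /rowP AV a; rewrite -(mem_Plt Hgr) => aP.
have ai : (index a (Plt H s) < size (Plt H s))%N by rewrite index_mem.
have := AV (Ordinal ai); rewrite !mxE => AV0; rewrite -[RHS]AV0.
by apply: eq_bigr => i _; rewrite !mxE nth_index.
Qed.

Let form_bound (S : 'M[R]_n) (M : R) (u : 'cV[R]_n) : (forall a b, `|S a b| <= M) ->
  (u^T *m S *m u) 0 0 <= n%:R * M * \sum_a u a 0 ^+ 2.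
Proof.
move=> SM; rewrite mxE.
apply: (@le_trans _ _ (\sum_b \sum_a M * ((u a 0 ^+ 2 + u b 0 ^+ 2) / 2))).
  apply: ler_sum => b _; rewrite mxE mulr_suml; apply: ler_sum => a _.
  rewrite mxE; apply: le_trans (ler_norm _) _; rewrite !normrM.
  rewrite (mulrC `|u a 0|) -mulrA; apply: ler_pM; rewrite ?mulr_ge0 //.
  rewrite -[u a 0 ^+ 2]real_normK ?num_real // -[u b 0 ^+ 2]real_normK ?num_real //.
  have := sqr_ge0 (`|u a 0| - `|u b 0|); rewrite sqrrB; lra.
have -> : \sum_b \sum_a M * ((u a 0 ^+ 2 + u b 0 ^+ 2) / 2) =
    \sum_(b < n) (M / 2 * \sum_a u a 0 ^+ 2) + \sum_b (M / 2 * (u b 0 ^+ 2 *+ n)).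
  rewrite -big_split; apply: eq_bigr => b _ /=.
  rewrite (eq_bigr (fun a => M / 2 * u a 0 ^+ 2 + M / 2 * u b 0 ^+ 2)) => [|a _].
    by rewrite big_split /= -mulr_sumr sumr_const card_ord mulrnAr.
  by field.
rewrite sumr_const card_ord -mulr_sumr sumrMnl.
set q := \sum_a _; rewrite -(mulr_natl q) -(mulr_natl (_ * q)) le_eqVlt; by apply/orP; left; apply/eqP; field.
Qed.

Lemma near_small (b : R) : 0 < b -> \forall e \near (0 : R)^'+, 0 < e < b.
Proof.
move=> b0; near=> e; apply/andP; split; near: e.
  exact: nbhs_right_gt.
exact: nbhs_right_lt.
Unshelve. all: by end_near. Qed.

Lemma lam_ge0 : \forall e \near (0 : R)^'+, forall i, 0 <= lam i e.
Proof.
near=> e => i.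
have /andP[ee ed] : 0 < e < del by near: e; exact: near_small.
have /andP[_ ee0] : 0 < e < e0 by near: e; exact: near_small.
have h : 0 <= e < del by rewrite ltW.
apply: (@psd_eigenvalue_ge0 _ _ _ (PP h) (P1 h) (PT h) (lam^~ e)).
by rewrite -KE //; apply: (Kpsd _).2; rewrite !ltW.
Unshelve. all: by end_near. Qed.

Lemma form_ker_bound s : (s <= k)%N -> exists M : R, \forall e \near (0 : R)^'+,
  forall u : 'cV[R]_n, u^T *m Vmx x (Plt H s) = 0 ->
  (u^T *m Keps K x e *m u) 0 0 <= M * e ^+ (2 * s) * \sum_a u a 0 ^+ 2.
Proof.
(* [Pi] fixes every [u] in the kernel, so the forms at all such [u] are controlled by the finitely
   many entries of [Pi^T K_e Pi]. This makes the bound uniform in [u]. *)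
move=> sk; pose N := kermx (Vmx x (Plt H s)); pose Pi := (pinvmx N *m N)^T.
have PiV : Pi^T *m Vmx x (Plt H s) = 0 by rewrite trmxK -mulmxA mulmx_ker mulmx0.
have kills (b : 'I_n) a : (mdeg a < s)%N -> \sum_i Pi i b * mono a (x i) = 0.
  by apply: kills_Vmx; rewrite PiV row0.
have Piu (u : 'cV[R]_n) : u^T *m Vmx x (Plt H s) = 0 -> Pi *m u = u.
  move=> /sub_kermxP uN; apply: trmx_inj; rewrite trmx_mul trmxK mulmxA.
  exact: mulmxKpV.
pose lim a b := \sum_(be <- H s) \sum_(al <- H s)
  (\sum_i Pi i a * mono al (x i)) * wcoef K al be * (\sum_i Pi i b * mono be (x i)).
have cv a b : kform (Pi^~ a) (Pi^~ b) e / e ^+ (s + s) @[e --> 0^'+] --> lim a b.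
  exact: (kernel_form_cvg Hgr Om_open Om0 KC sk sk (kills a) (kills b)).
(* The extra 1 absorbs the distance of each rescaled entry to its limit. *)
pose M := \sum_a \sum_b `|lim a b| + 1.
exists (n%:R * M); near=> e => u uV.
have /andP[ee _] : 0 < e < 1 by near: e; exact: near_small.
have hM : forall ab : 'I_n * 'I_n, ab \in enum {: 'I_n * 'I_n} ->
    `|kform (Pi^~ ab.1) (Pi^~ ab.2) e| <= M * e ^+ (2 * s).
  near: e; apply: near_all_seq => -[a b] _.
  have := cv a b => /cvgrPdist_le /(_ 1 ltr01); move: (near_small ltr01).
  apply: filterS2 => e /andP[ee _] /= he.
  have ep : 0 < e ^+ (s + s) by rewrite exprn_gt0.
  rewrite mul2n -addnn -ler_pdivrMr // -{1}(gtr0_norm ep) -normfV -normrM.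
  set q := _ / _ in he *.
  have : `|lim a b| <= \sum_a \sum_b `|lim a b|.
    rewrite (bigD1 a) //= (bigD1 b) //= -addrA lerDl addr_ge0 ?sumr_ge0 // => i _.
    exact: sumr_ge0.
  have := ler_normB (lim a b) (lim a b - q); rewrite subKr /M.
  by move=> h1 h2; apply: le_trans h1 _; apply: lerD.
rewrite -(Piu u uV) trmx_mul -!mulmxA (mulmxA Pi^T) (mulmxA (Pi^T *m _)) mulmxA Piu //.
rewrite -[n%:R * M * _]mulrA; apply: form_bound => a b; rewrite kformE.
by apply: (hM (a, b)); rewrite mem_enum.
Unshelve. all: by end_near. Qed.

Lemma lam_bound s (i : 'I_n) : (s <= k)%N -> (\rank (Vmx x (Plt H s)) <= i)%N ->
  exists C b : R, 0 < b /\ forall e, 0 < e < b -> `|lam i e| <= C * e ^+ (2 * s).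
Proof.
move=> sk rk; have [M hM] := form_ker_bound sk.
suff : \forall e \near (0 : R)^'+, `|lam i e| <= M * e ^+ (2 * s).
  case => b /= b0 hb; exists M, b; split => // e /andP[ee eb]; apply: hb => //=.
  by rewrite sub0r normrN gtr0_norm.
near=> e; have l0 : forall i, 0 <= lam i e by near: e; exact: lam_ge0.
have hde : 0 < e < del by near: e; exact: near_small.
have h : 0 <= e < del by case/andP: hde => /ltW ->.
rewrite ger0_norm //.
apply: (@eigenvalue_le _ _ _ (PP h) (P1 h) (PT h) (lam^~ e) _ (Vmx x (Plt H s))) => //.
  by move=> j; exact: lam_sorted.
by rewrite -KE //; near: e.
Unshelve. all: by end_near. Qed.

Lemma lam_leading (i : 'I_n) : exists a C b : R, 0 < b /\ forall e, 0 < e < b ->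
  `|lam i e - e ^+ (2 * idx_deg i) * a| <= C * e ^+ (2 * idx_deg i).+1.
Proof.
have [|C [b [b0 hC]]] := @lam_bound (idx_deg i) i (idx_deg_le i).
  by apply: leq_trans (rank_leq_col _) _; rewrite leqNgt idx_degP ltnn.
by apply: analytic0_leading_term (proj1 (lamP_analytic i)) b0 hC.
Qed.


Variable lt : 'I_n -> R.
Hypothesis lt_spec : forall i : 'I_n, exists C b : R, 0 < b /\ forall e, 0 < e < b ->
  `|lam i e - e ^+ (2 * idx_deg i) * lt i| <= C * e ^+ (2 * idx_deg i).+1.

Lemma lam_cvg (i : 'I_n) : lam i e / e ^+ (2 * idx_deg i) @[e --> 0^'+] --> lt i.
Proof.
have [C [b [b0 hC]]] := lt_spec i.
rewrite -[lt i]addr0.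
apply: near_right_eq_cvg (cvgD (cvg_cst (lt i)) (at_right_bound b0 hC)) => e e0'.
by rewrite mulrBl mulrAC mulfV ?mul1r ?subrKC // expf_neq0 // gt_eqF.
Qed.

Lemma lam_cvg_lower (i : 'I_n) N : (N <= 2 * idx_deg i)%N ->
  lam i e / e ^+ N @[e --> 0^'+] --> (N == 2 * idx_deg i)%:R * lt i.
Proof. by move=> hN; apply: (cvg_div_lower_pow hN); exact: lam_cvg. Qed.

Lemma limit_coef_ge0 i : 0 <= lt i.
Proof.
rewrite -(cvg_lim _ (@lam_cvg i)) //; apply: limr_ge.
  by apply/cvg_ex; exists (lt i); exact: lam_cvg.
near=> e; rewrite mulr_ge0 ?invr_ge0 ?exprn_ge0 //.
by move: i; near: e; exact: lam_ge0.
Unshelve. all: by end_near. Qed.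

(** When V_(<=s-1) loses rank, some eigenvalue of an earlier group already decays like e^(2s),
    faster than the scale of its group. *)
Lemma limit_coef_eq0 s (i : 'I_n) : (s <= k)%N -> (\rank (Vmx x (Plt H s)) <= i)%N ->
  (idx_deg i < s)%N -> lt i = 0.
Proof.
move=> sk rk gs; have [C [b [b0 hC]]] := lam_bound sk rk.
have h : lam i e / e ^+ (2 * idx_deg i) @[e --> 0^'+] --> (0 : R).
  apply: (@at_right_bound _ `|C| (Num.min b 1)); rewrite ?lt_min ?b0 ?ltr01 //.
  move=> e; rewrite lt_min => /and3P[e_gt0 eb e1].
  apply: le_trans (hC e _) _; first by rewrite e_gt0.
  apply: (@le_trans _ _ (`|C| * e ^+ (2 * s))).
    by rewrite ler_wpM2r ?ler_norm // exprn_ge0 // ltW.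
  rewrite ler_wpM2l // ler_wiXn2l ?ltW //.
  by rewrite ltn_mul2l.
by apply: (cvg_unique _ (@lam_cvg i) h).
Qed.

Lemma limit_coef_first (i : 'I_n) : val i = 0%N -> lt i = n%:R * K (0, 0).
Proof.
move=> i0; have gi : idx_deg i = 0%N.
  by apply/eqP; rewrite -leqn0 -ltnS -idx_degP i0 size_Plt1.
(* At [e = 0] only the first eigenvalue survives, so it equals the trace of the constant matrix K(0,
   0). *)
have lam0 j : lam j 0 = (if j == i then lt i else 0).
  have c0 := analytic0_at_right (proj1 (lamP_analytic j)).
  have le : (0 <= 2 * idx_deg j)%N by [].
  have c1 : lam j e @[e --> 0^'+] --> (0 == 2 * idx_deg j)%N%:R * lt j.
    by apply: near_right_eq_cvg (lam_cvg_lower le) => e _; rewrite expr0 divr1.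
  rewrite (cvg_unique _ c0 c1) //; have [->|/eqP ji] := eqVneq j i; first by rewrite gi mul1r.
  suff : (0 < idx_deg j)%N by case: (idx_deg j) => // a; rewrite mul0r.
  rewrite lt0n; apply: contra_notN ji; rewrite -leqn0 -ltnS -idx_degP size_Plt1 //.
  by rewrite ltnS leqn0 => /eqP j0; apply/val_inj; rewrite i0.
have h : 0 <= (0 : R) < del by rewrite lexx.
have := mxtrace_sum_projectors (PP h) (P1 h) (lam^~ 0); rewrite -KE //.
rewrite (bigD1 i) //= big1 ?addr0 => [|j /negPf ji]; last by rewrite lam0 ji.
rewrite lam0 eqxx => <-; rewrite /mxtrace; under eq_bigr do rewrite mxE !scale0r.
by rewrite sumr_const card_ord mulr_natl.
Qed.

(* Rows of degree t >= S are scaled by e^S, columns by e^T.  For T = S the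
   shift [c] is a variable whose polynomial identity yields item 2; for
   T = S-1 it dominates the block orthogonal to V and isolates item 1. *)
Lemma det_limit S T m' (U : 'M[R]_(n, m')) (c : R) :
  let V := Vmx x (Plt H S) in let VS := Vmx x (H S) in
  (S <= k)%N -> (T <= S <= T.+1)%N -> (0 < S)%N ->
  (size (Plt H S) + m')%N = n -> V^T *m V \in unitmx -> U^T *m V = 0 ->
  \det (block_mx (Wmx K (Plt H S) (Plt H S))
    ((T == S)%:R *: (Wmx K (Plt H S) (H S) *m VS^T *m U))
    (U^T *m VS *m Wmx K (H S) (Plt H S))
    ((T == S)%:R *: (U^T *m VS *m Wmx K (H S) (H S) *m VS^T *m U) + c *: (U^T *m U))) =
  \det (U^T *m U) / \det (V^T *m V) *
  \prod_(i < n) (if (idx_deg i < S)%N then lt i else (S + T == 2 * idx_deg i)%N%:R * lt i + c).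
Proof.
move=> V VS Sk /andP[TS ST] S0 En Vu UV.
set m := size (Plt H S) in En *.
pose G := invmx (V^T *m V).
have GT : G^T = G by rewrite trmx_inv trmx_mul trmxK.
pose B1 := V *m G.
have B1V : B1^T *m V = 1%:M by rewrite trmx_mul GT -mulmxA mulVmx.
have VU : V^T *m U = 0 by apply: trmx_inj; rewrite trmx_mul trmxK trmx0.
pose B := row_mx B1 U.
have BTB : B^T *m B = block_mx G 0 0 (U^T *m U).
  have B1B1 : B1^T *m B1 = G by rewrite -[LHS]/(B1^T *m (V *m G)) mulmxA B1V mul1mx.
  have B1U : B1^T *m U = 0 by rewrite /B1 trmx_mul -mulmxA VU mulmx0.
  have UB1 : U^T *m B1 = 0 by rewrite /B1 mulmxA UV mul0mx.
  by rewrite tr_row_mx mul_col_row B1B1 B1U UB1.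
(* A dual vector gets the degree of its monomial as both exponents, a column of [U] gets [S] as row
   and [T] as column. Read on eigenvalue indices, the same formulas give the powers dividing the
   [f i], so determinant and product carry the same power of [e]. *)
pose gd (a : nat) := mdeg (nth (mi0 d) (Plt H k.+1) a).
pose p_ (a : nat) := minn (gd a) S; pose q_ (a : nat) := minn (gd a) T.
have gdl (j : 'I_m) : gd j = mdeg (nth (mi0 d) (Plt H S) j) /\ (gd j < S)%N.
  have E : gd j = mdeg (nth (mi0 d) (Plt H S) j) by rewrite /gd (@nth_Plt _ H S) // leqW.
  by rewrite E; split => //; rewrite -(mem_Plt Hgr) mem_nth.
have gdr (j : 'I_m') : (S <= gd (m + j))%N.
  have mj : (m + j < n)%N by rewrite -{1}En ltn_add2l.
  by rewrite leqNgt -(idx_degP (Ordinal mj)) /= -leqNgt leq_addr.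
have coefl (j : 'I_m) a : (mdeg a < S)%N ->
    \sum_i B i (lshift m' j) * mono a (x i) = (a == nth (mi0 d) (Plt H S) j)%:R.
  rewrite -(mem_Plt Hgr) => aP.
  have ai : (index a (Plt H S) < m)%N by rewrite index_mem.
  transitivity ((B1^T *m V) j (Ordinal ai)).
    by rewrite [RHS]mxE; apply: eq_bigr => i _; rewrite row_mxEl [in RHS]mxE [V _ _]mxE nth_index.
  rewrite B1V mxE -val_eqE /= eq_sym; congr (_%:R).
  by rewrite -[a in RHS](nth_index (mi0 d) aP) nth_uniq ?uniq_Plt.
have killl (j : 'I_m) a : (mdeg a < mdeg (nth (mi0 d) (Plt H S) j))%N ->
    \sum_i B i (lshift m' j) * mono a (x i) = 0.
  have [-> jS] := gdl j => aj; rewrite coefl; last exact: ltn_trans jS.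
  by case: eqP aj => [->|//]; rewrite ltnn.
have killr (j : 'I_m') a : (mdeg a < S)%N -> \sum_i B i (rshift m j) * mono a (x i) = 0.
  under eq_bigr do rewrite row_mxEr; apply: kills_Vmx.
  by rewrite -/V UV row0.
have sumB (F : mi d -> R) (j : 'I_m) :
    \sum_(a <- H (mdeg (nth (mi0 d) (Plt H S) j)))
      (\sum_i B i (lshift m' j) * mono a (x i)) * F a = F (nth (mi0 d) (Plt H S) j).
  have [E jS] := gdl j.
  rewrite (bigD1_seq (nth (mi0 d) (Plt H S) j)) ?mem_H //=; last exact: (proj1 (Hgr _)).
  have nS : (mdeg (nth (mi0 d) (Plt H S) j) < S)%N by rewrite -E.
  rewrite (coefl j _ nS) eqxx mul1r big_seq_cond big1 ?addr0 // => a.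
  rewrite mem_H // => /andP[/eqP aj /negPf ne].
  by rewrite coefl ?aj // ne mul0r.
have sumU (F : mi d -> R) (j : 'I_m') :
    \sum_(a <- H S) (\sum_i B i (rshift m j) * mono a (x i)) * F a =
    \sum_(l < size (H S)) (U^T *m VS) j l * F (nth (mi0 d) (H S) l).
  rewrite (big_nth (mi0 d)) big_mkord; apply: eq_bigr => l _; congr (_ * _).
  by rewrite [RHS]mxE; apply: eq_bigr => i _; rewrite row_mxEr [in RHS]mxE [VS _ _]mxE.
have pl (j : 'I_m) : p_ j = gd j /\ q_ j = gd j.
  have [_ jS] := gdl j; rewrite /p_ /q_; split; apply/minn_idPl; first exact: ltnW.
  by rewrite -ltnS (leq_trans jS).
have pr (j : 'I_m') : p_ (m + j)%N = S /\ q_ (m + j)%N = T.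
  have Sj := gdr j; rewrite /p_ /q_; split; apply/minn_idPr => //.
  exact: leq_trans Sj.
have kill (a : 'I_(m + m')) al : (mdeg al < p_ a)%N -> \sum_i B i a * mono al (x i) = 0.
  case: (split_ordP a) => j ->; last by rewrite /= (pr j).1; exact: killr.
  by rewrite /= (pl j).1 (gdl j).1; exact: killl.
have pS a : (p_ a <= S)%N by rewrite geq_minr.
have qT a : (q_ a <= T)%N by rewrite geq_minr.
have qp a : (q_ a <= p_ a)%N by rewrite leq_min geq_minl (leq_trans (geq_minr _ _) TS).
pose lim (a b : 'I_(m + m')) := \sum_(be <- H (p_ b)) \sum_(al <- H (p_ a))
  (\sum_i B i a * mono al (x i)) * wcoef K al be * (\sum_i B i b * mono be (x i)).
pose X e := B^T *m (Keps K x e + (c * e ^+ (S + T))%:M) *m B.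
pose F e := \matrix_(a, b) (e ^- p_ a * X e a b * e ^- q_ b).
(* A form entry survives when [q_ b = p_ b]. The shift survives when [p_ a + q_ b] reaches [S + T];
   outside the [U] block this happens only where [B^T *m B] vanishes. *)
pose L0 (a b : 'I_(m + m')) := (p_ a + q_ b == p_ a + p_ b)%N%:R * lim a b +
   (p_ a + q_ b == S + T)%N%:R * (c * (B^T *m B) a b).
have cvF a b : F e a b @[e --> 0^'+] --> L0 a b.
  have cv1 := @kernel_form_cvg _ _ _ Hgr Om k K Om_open Om0 KC n x
    (B^~ a) (B^~ b) _ _ (leq_trans (pS a) Sk) (leq_trans (pS b) Sk) (@kill a) (@kill b).
  have le1 : (p_ a + q_ b <= p_ a + p_ b)%N by rewrite leq_add2l.
  have cv2 := cvg_div_lower_pow le1 cv1.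
  have le2 : (p_ a + q_ b <= S + T)%N by rewrite leq_add.
  have cv3 : e ^+ (S + T - (p_ a + q_ b)) * (c * (B^T *m B) a b) @[e --> 0^'+] -->
      (p_ a + q_ b == S + T)%N%:R * (c * (B^T *m B) a b).
    apply: cvgM; last exact: cvg_cst.
    by have := @cvg_pow0 R (S + T - (p_ a + q_ b)); rewrite subn_eq0 eqn_leq le2.
  apply: near_right_eq_cvg (cvgD cv2 cv3) => e e_gt0.
  have ep N : e ^+ N != 0 by rewrite expf_neq0 // gt_eqF.
  have XE : X e a b = kform (B^~ a) (B^~ b) e + c * e ^+ (S + T) * (B^T *m B) a b.
    rewrite /X mulmxDr mulmxDl mul_mx_scalar -scalemxAl [LHS]mxE kformE.
    by congr (_ + _); rewrite [LHS]mxE.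
  have -> : F e a b = e ^- p_ a * X e a b * e ^- q_ b by rewrite mxE.
  have ES : e ^+ (S + T) = e ^+ (S + T - (p_ a + q_ b)) * (e ^+ p_ a * e ^+ q_ b).
    by rewrite -!exprD subnK.
  rewrite XE ES -/(kform (B^~ a) (B^~ b) e) (exprD e (p_ a) (q_ b)).
  move: (ep (p_ a)) (ep (q_ b)) (kform _ _ _) ((B^T *m B) a b) => {XE ES le1 cv2 cv1 cv3}.
  move: (e ^+ p_ a) (e ^+ q_ b) (e ^+ _) => y z w y0 z0 kf g.
  by field; rewrite y0 z0.
(* On a dual vector this pairing evaluates [h] at a single multi-index; on a column of [U] it sums
   [h] against a row of [U^T V_S]. *)
pose Phi (a : 'I_(m + m')) (h : mi d -> R) :=
  \sum_(al <- H (p_ a)) (\sum_i B i a * mono al (x i)) * h al.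
have PhiL j h : Phi (lshift m' j) h = h (nth (mi0 d) (Plt H S) j).
  by rewrite /Phi [p_ _](pl j).1 (gdl j).1 sumB.
have PhiR j h : Phi (rshift m j) h =
    \sum_(l < size (H S)) (U^T *m VS) j l * h (nth (mi0 d) (H S) l).
  by rewrite /Phi [p_ _](pr j).1 sumU.
have limE a b : lim a b = Phi b (fun be => Phi a (fun al => wcoef K al be)).
  by apply: eq_bigr => be _; rewrite [RHS]mulrC mulr_suml.
have z0 q r (i : 'I_q) (j : 'I_r) : (0 : 'M[R]_(q, r)) i j = 0 by rewrite mxE.
have WE (A1 : seq (mi d)) (A2 : seq (mi d)) (i : 'I_(size A1)) (j : 'I_(size A2)) :
    wcoef K (nth (mi0 d) A1 i) (nth (mi0 d) A2 j) = Wmx K A1 A2 i j by rewrite mxE.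
have UVE (j : 'I_m') l : (U^T *m VS) j l = (VS^T *m U) l j.
  have -> : VS^T *m U = (U^T *m VS)^T by rewrite trmx_mul trmxK.
  by rewrite [RHS]mxE.
have -> : block_mx (Wmx K (Plt H S) (Plt H S))
    ((T == S)%:R *: (Wmx K (Plt H S) (H S) *m VS^T *m U))
    (U^T *m VS *m Wmx K (H S) (Plt H S))
    ((T == S)%:R *: (U^T *m VS *m Wmx K (H S) (H S) *m VS^T *m U) + c *: (U^T *m U)) =
    \matrix_(a, b) L0 a b.
  apply/matrixP => a b; rewrite [RHS]mxE /L0 limE BTB.
  case: (split_ordP a) => {}a ->; case: (split_ordP b) => {}b ->;
    rewrite ?(block_mxEul, block_mxEur, block_mxEdl, block_mxEdr) ?PhiL ?PhiR.
  - rewrite [p_ (lshift _ a)](pl a).1 [p_ (lshift _ b)](pl b).1 [q_ (lshift _ b)](pl b).2.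
    rewrite eqxx mul1r WE // ltn_eqF ?mul0r ?addr0 //.
    rewrite -addSn leq_add ?(gdl _).2 // -ltnS (leq_trans (gdl b).2) //.
  - rewrite [p_ (lshift _ a)](pl a).1 [p_ (rshift _ b)](pr b).1 [q_ (rshift _ b)](pr b).2.
    rewrite z0 !mulr0 addr0 eqn_add2l [LHS]mxE; congr (_ * _).
    rewrite -mulmxA mxE; apply: eq_bigr => l _.
    by rewrite PhiL WE // UVE mulrC.
  - rewrite [p_ (rshift _ a)](pr a).1 [p_ (lshift _ b)](pl b).1 [q_ (lshift _ b)](pl b).2.
    rewrite z0 !mulr0 addr0 eqxx mul1r.
    by rewrite mxE; apply: eq_bigr => l _; rewrite WE.
  - rewrite [p_ (rshift _ a)](pr a).1 [p_ (rshift _ b)](pr b).1 [q_ (rshift _ b)](pr b).2.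
    rewrite eqxx mul1r eqn_add2l mxE; congr (_ + _); last by rewrite mxE.
    rewrite mxE; congr (_ * _); rewrite -mulmxA mxE; apply: eq_bigr => l _.
    by rewrite PhiR mulrC -UVE; congr (_ * _); rewrite mxE; apply: eq_bigr => l' _; rewrite WE.
have cvdet : \det (F e) @[e --> 0^'+] --> \det (\matrix_(a, b) L0 a b).
  by apply: cvg_det => a b; rewrite [X in _ --> X]mxE.
pose f (i : 'I_n) e := (lam i e + c * e ^+ (S + T)) / e ^+ (p_ i + q_ i).
have cvf i : f i e @[e --> 0^'+] -->
    (if (idx_deg i < S)%N then lt i else (S + T == 2 * idx_deg i)%N%:R * lt i + c).
  have le1 : (p_ i + q_ i <= 2 * idx_deg i)%N.
    by rewrite mul2n -addnn leq_add // geq_minl.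
  have le2 : (p_ i + q_ i <= S + T)%N by rewrite leq_add.
  have cv1 := lam_cvg_lower le1.
  have cv2 : e ^+ (S + T - (p_ i + q_ i)) * c @[e --> 0^'+] -->
      ((S + T - (p_ i + q_ i))%N == 0%N)%:R * c.
    by apply: cvgM; [exact: cvg_pow0 | exact: cvg_cst].
  have -> : (if (idx_deg i < S)%N then lt i else (S + T == 2 * idx_deg i)%N%:R * lt i + c) =
     (p_ i + q_ i == 2 * idx_deg i)%N%:R * lt i + ((S + T - (p_ i + q_ i))%N == 0%N)%:R * c.
    case: ltnP => gS.
      have pg : p_ i = idx_deg i by apply/minn_idPl/ltnW.
      have qg : q_ i = idx_deg i by apply/minn_idPl; rewrite -ltnS (leq_trans gS).
      rewrite pg qg addnn -mul2n eqxx mul1r subn_eq0 leqNgt.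
      rewrite mul2n -addnn -addSn leq_add ?mul0r ?addr0 //.
      by rewrite -ltnS (leq_trans gS).
    have pg : p_ i = S by apply/minn_idPr.
    have qg : q_ i = T by apply/minn_idPr; exact: leq_trans gS.
    by rewrite pg qg subnn mul1r.
  apply: near_right_eq_cvg (cvgD cv1 cv2) => e e_gt0.
  have ep N : e ^+ N != 0 by rewrite expf_neq0 // gt_eqF.
  rewrite /f mulrDl; congr (_ + _); rewrite mulrC -[RHS]mulrA; congr (_ * _).
  by rewrite -{2}(subnK le2) exprD mulfK.
have cvprod : \det (B^T *m B) * \prod_i f i e @[e --> 0^'+] -->
   \det (B^T *m B) * \prod_i (if (idx_deg i < S)%N then lt i
     else (S + T == 2 * idx_deg i)%N%:R * lt i + c).
  by apply: cvgM; [exact: cvg_cst | exact: cvg_prod_fin].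
have -> : \det (U^T *m U) / \det (V^T *m V) = \det (B^T *m B).
  by rewrite BTB det_ublock det_inv mulrC.
apply: (cvg_unique _ cvdet) => //.
have : \forall e \near (0 : R)^'+, \det (B^T *m B) * \prod_i f i e = \det (F e).
  near=> e.
  have hde : 0 < e < del by near: e; exact: near_small.
  have h : 0 <= e < del by case/andP: hde => /ltW ->.
  rewrite /F det_scale /X det_congruence // -mulrA; congr (_ * _).
  have -> : Keps K x e + (c * e ^+ (S + T))%:M = \sum_i (lam i e + c * e ^+ (S + T)) *: P i e.
    rewrite KE // -scalemx1 -(sum_projectors (PP h) (P1 h)) scaler_sumr -big_split.
    by apply: eq_bigr => i _; rewrite scalerDl.
  rewrite (det_sum_projectors (PP h) (P1 h)).
  rewrite (reindex (cast_ord En)) /=; last first.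
    by exists (cast_ord (esym En)) => a _; rewrite ?cast_ordK ?cast_ordKV.
  rewrite [X in _ = X * _](reindex (cast_ord En)) /=; last first.
    by exists (cast_ord (esym En)) => a _; rewrite ?cast_ordK ?cast_ordKV.
  rewrite -big_split; apply: eq_bigr => a _ /=.
  by rewrite /f -invfM -exprD.
by move=> h; apply: cvg_trans cvprod; apply: near_eq_cvg; exact: h.
Unshelve. all: by end_near. Qed.


Lemma det_gram_Wmx S : (0 < S <= k)%N ->
  \prod_(i < n | (idx_deg i < S)%N) lt i =
  \det ((Vmx x (Plt H S))^T *m Vmx x (Plt H S)) * \det (Wmx K (Plt H S) (Plt H S)).
Proof.
case: S => // T /= Sk; set S := T.+1; set V := Vmx x (Plt H S).
have sizeS : (size (Plt H S) < n)%N.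
  by case/andP: hn => + _; apply: leq_ltn_trans; exact: size_Plt_mono.
(* Without full rank both sides are zero: the last index before [size (Plt H S)] has limit
   coefficient 0. *)
have [rV|rV] := eqVneq (\rank V) (size (Plt H S)); last first.
  have rlt : (\rank V < size (Plt H S))%N by rewrite ltn_neqAle rV rank_leq_col.
  have -> : \det (V^T *m V) = 0.
    apply/eqP; apply: contraTT rlt => dV; rewrite -leqNgt.
    have VV : V^T *m V \in unitmx by rewrite unitmxE unitfE.
    by rewrite -{1}(mxrank_unit VV); exact: mxrankM_maxr.
  have i0n : ((size (Plt H S)).-1 < n)%N by apply: leq_ltn_trans (leq_pred _) sizeS.
  pose i0 := Ordinal i0n.
  have Sp : (0 < size (Plt H S))%N by apply: leq_ltn_trans rlt.
  have gi0 : (idx_deg i0 < S)%N by rewrite -idx_degP /= prednK.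
  rewrite mul0r (bigD1 i0) //= (@limit_coef_eq0 S) ?mul0r //.
  by rewrite -ltnS /= prednK.
have VV := row_free_gram_unit rV.
pose U := (row_base (kermx V))^T.
have En : (size (Plt H S) + \rank (kermx V))%N = n.
  by rewrite mxrank_ker rV subnKC // ltnW.
have UV : U^T *m V = 0.
  by rewrite trmxK; apply/sub_kermxP; rewrite eq_row_base.
have UU : U^T *m U \in unitmx.
  by apply: row_free_gram_unit; rewrite mxrank_tr eq_row_base.
(* With [T = S - 1] the limit matrix is block lower triangular, and with [c = 1] every factor with
   [idx_deg i >= S] tends to 1, since [S + T < 2 * idx_deg i]. *)
have := @det_limit S T _ U 1 Sk _ isT En VV UV; rewrite leqnn leqnSn => /(_ isT).
have -> : (T == S) = false by rewrite ltn_eqF.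
rewrite !scale0r add0r scale1r det_lblock => D.
have UU0 : \det (U^T *m U) != 0 by rewrite -unitfE -unitmxE.
have VV0 : \det (V^T *m V) != 0 by rewrite -unitfE -unitmxE.
have -> : \prod_(i < n | (idx_deg i < S)%N) lt i = \prod_(i < n)
    (if (idx_deg i < S)%N then lt i else (S + T == 2 * idx_deg i)%N%:R * lt i + 1).
  rewrite big_mkcond /=; apply: eq_bigr => i _; case: ltnP => // gS.
  rewrite ltn_eqF ?mul0r ?add0r // mul2n -addnn.
  by rewrite -addnS leq_add.
apply: (mulfI UU0); apply: (mulIf (invr_neq0 VV0)).
rewrite mulrAC -D; set a := \det (Wmx _ _ _); set b := \det _; set c := \det _.
by field.
Qed.

Lemma prod_group s : \prod_(i < n | (idx_deg i < s.+1)%N) lt i =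
  \prod_(i < n | (idx_deg i < s)%N) lt i * \prod_(i < n | grp H s i) lt i.
Proof.
rewrite (bigID (fun i => (idx_deg i < s)%N)) /=; congr (_ * _).
  by apply: eq_bigl => i; rewrite ltnS andb_idl // => /ltnW.
by apply: eq_bigl => i; rewrite grpE -leqNgt ltnS eqn_leq.
Qed.

Lemma prod_lt_grp s : (1 <= s < k)%N ->
  \det (Wmx K (Plt H s) (Plt H s)) != 0 ->
  \rank (Vmx x (Plt H s)) = size (Plt H s) ->
  \prod_(i < n | grp H s i) lt i =
    \det ((Vmx x (Plt H s.+1))^T *m Vmx x (Plt H s.+1)) *
    \det (Wmx K (Plt H s.+1) (Plt H s.+1)) /
    (\det ((Vmx x (Plt H s))^T *m Vmx x (Plt H s)) * \det (Wmx K (Plt H s) (Plt H s))).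
Proof.
case/andP=> s1 sk W0 rV; have VV := row_free_gram_unit rV.
rewrite unitmxE unitfE in VV.
have A0 := @det_gram_Wmx s; rewrite s1 ltnW // in A0; have {}A0 := A0 isT.
rewrite -(@det_gram_Wmx s.+1) // -A0 prod_group mulrC mulKf // A0.
by rewrite mulf_neq0.
Qed.


Hypothesis Pp : forall i, P i 0 = p i *m (p i)^T.

Let pm : 'M[R]_n := \matrix_(a, b) p b a 0.

(** The trace of [P i 0] is 1 and that of [P i 0 *m P j 0] is the squared inner product of [p i] and
    [p j]. *)
Lemma pm_gram : pm^T *m pm = 1%:M.
Proof.
have h0 : 0 <= (0 : R) < del by rewrite lexx.
pose dot i j := ((p i)^T *m p j) 0 0.
have trP i : \tr (P i 0) = 1.
  have := mxtrace_sum_projectors (PP h0) (P1 h0) (fun j => (j == i)%:R).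
  rewrite !(bigD1 (P := xpredT) i) //= !big1 ?addr0 ?eqxx ?scale1r // => j /negPf -> //.
  by rewrite scale0r.
have tr1 (A : 'M[R]_1) : \tr A = A 0 0 by rewrite /mxtrace big_ord1.
have dotC i j : dot i j = dot j i.
  by rewrite /dot -[in LHS](trmxK (p j)) -trmx_mul mxE.
have trPP i j : \tr (P i 0 *m P j 0) = dot i j ^+ 2.
  rewrite !Pp mulmxA -(mulmxA (p i)) [(p i)^T *m p j]mx11_scalar mul_mx_scalar.
  by rewrite -scalemxAl mxtraceZ mxtrace_mulC tr1 -/(dot i j) -/(dot j i) (dotC j) expr2.
apply/matrixP => i j; have -> : (pm^T *m pm) i j = dot i j.
  by rewrite /dot !mxE; apply: eq_bigr => l _; rewrite !mxE.
rewrite mxE; case: (eqVneq i j) => [<-|ij].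
  by rewrite -(trP i) Pp mxtrace_mulC tr1.
have := trPP i j; rewrite (PP h0) (negPf ij) mxtrace0 => /eqP.
by rewrite eq_sym sqrf_eq0 => /eqP.
Qed.

(** Divided by e^(2 idx_deg i), the inequality becomes [lt i] times the squared inner product [<= 0]
    in the limit, and [lt i > 0]. *)
Lemma limit_eigenvector_orth S (i : 'I_n) (u : 'cV[R]_n) : (S <= k)%N ->
  (idx_deg i < S)%N -> lt i != 0 -> u^T *m Vmx x (Plt H S) = 0 ->
  (u^T *m p i) 0 0 = 0.
Proof.
move=> Sk gS lti uV; have [M hM] := form_ker_bound Sk.
set N2 := \sum_a u a 0 ^+ 2 in hM *.
have h0 : 0 <= (0 : R) < del by rewrite lexx.
have cq : (u^T *m P i e *m u) 0 0 @[e --> 0^'+] --> (u^T *m P i 0 *m u) 0 0.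
  have E e : (u^T *m P i e *m u) 0 0 = \sum_b (\sum_a u a 0 * P i e a b) * u b 0.
    by rewrite !mxE; apply: eq_bigr => b _; rewrite !mxE; congr (_ * _);
      apply: eq_bigr => a _; rewrite mxE.
  rewrite E; under eq_fun do rewrite E.
  apply: cvg_big => [|b _]; first exact: add_continuous.
  apply: cvgM; last exact: cvg_cst.
  apply: cvg_big => [|a _]; first exact: add_continuous.
  apply: cvgM; first exact: cvg_cst.
  by apply: analytic0_at_right; exact: (lamP_analytic i).2.
have c1 : lam i e / e ^+ (2 * idx_deg i) * (u^T *m P i e *m u) 0 0 @[e --> 0^'+] -->
    lt i * (u^T *m P i 0 *m u) 0 0 by apply: cvgM => //; exact: lam_cvg.
have c2 : e ^+ (2 * S - 2 * idx_deg i) * (M * N2) @[e --> 0^'+] -->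
    ((2 * S - 2 * idx_deg i)%N == 0%N)%:R * (M * N2).
  by apply: cvgM; [exact: cvg_pow0 | exact: cvg_cst].
have z2 : ((2 * S - 2 * idx_deg i)%N == 0%N)%:R * (M * N2) = 0.
  by rewrite -mulnBr muln_eq0 /= subn_eq0 leqNgt gS mul0r.
rewrite z2 in c2.
have le : lt i * (u^T *m P i 0 *m u) 0 0 <= 0.
  apply: (ler_cvg_to c1 c2); near=> e.
  have hde : 0 < e < del by near: e; exact: near_small.
  have h : 0 <= e < del by case/andP: hde => /ltW ->.
  have e_gt0 : 0 < e by case/andP: hde.
  have l0 : forall j, 0 <= lam j e by near: e; exact: lam_ge0.
  have hMe : forall v : 'cV[R]_n, v^T *m Vmx x (Plt H S) = 0 ->
      (v^T *m Keps K x e *m v) 0 0 <= M * e ^+ (2 * S) * \sum_a v a 0 ^+ 2.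
    by near: e; exact: hM.
  have := hMe u uV; rewrite -/N2.
  rewrite KE // form_sum_projectors (bigD1 i) //=.
  set rest := \sum_(j < n | _) _; have r0 : 0 <= rest.
    by apply: sumr_ge0 => j _; rewrite mulr_ge0 // (form_projector_ge0 (PP h) (PT h)).
  move=> le1; rewrite mulrAC ler_pdivrMr ?exprn_gt0 //.
  have -> : e ^+ (2 * S - 2 * idx_deg i) * (M * N2) * e ^+ (2 * idx_deg i) =
      M * e ^+ (2 * S) * N2.
    by rewrite mulrAC -exprD subnK; [ring | rewrite leq_mul2l ltnW].
  by apply: le_trans le1; rewrite lerDl.
have lp : 0 < lt i by rewrite lt_neqAle eq_sym lti limit_coef_ge0.
have : (u^T *m P i 0 *m u) 0 0 = (u^T *m p i) 0 0 ^+ 2.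
  have pu : (p i)^T *m u = (u^T *m p i)^T by rewrite trmx_mul trmxK.
  rewrite Pp mulmxA -mulmxA pu; set c := (_ 0 0 in RHS).
  by rewrite [u^T *m p i]mx11_scalar -/c tr_scalar_mx -scalar_mxM mxE eqxx mulr1n expr2.
move=> E; rewrite E pmulr_rle0 // in le.
by apply/eqP; rewrite -sqrf_eq0 eq_le le sqr_ge0.
Unshelve. all: by end_near. Qed.

(** * Comparison with the orthogonal factor of the QR factorization *)

Section QR.
Variables (Q : 'M[R]_n) (Rf : 'M[R]_(n, size (Plt H k))).
Hypothesis QTQ : Q^T *m Q = 1%:M.
Hypothesis Rf_upper : forall (i : 'I_n) (j : 'I_(size (Plt H k))), (j < i)%N -> Rf i j = 0.
Hypothesis VQR : Vmx x (Plt H k) = Q *m Rf.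

Lemma QR_col_orth t (i : 'I_n) a : (t <= k)%N -> (size (Plt H t) <= i)%N ->
  (mdeg a < t)%N -> \sum_l Q l i * mono a (x l) = 0.
Proof.
move=> tk ti; rewrite -(mem_Plt Hgr) => aP.
have [r E] := Plt_cat H tk.
have aPk : a \in Plt H k by rewrite E mem_cat aP.
have ak : (index a (Plt H k) < size (Plt H k))%N by rewrite index_mem.
have : (Q^T *m Vmx x (Plt H k)) i (Ordinal ak) = 0.
  rewrite VQR mulmxA QTQ mul1mx Rf_upper //= E index_cat aP.
  by apply: leq_trans ti; rewrite index_mem.
rewrite mxE => S0; rewrite -[RHS]S0; apply: eq_bigr => l _.
by rewrite [in RHS]mxE [Vmx _ _ _ _]mxE nth_index.
Qed.

Lemma Q_gram lo N lo' N' : (lo + N <= n)%N -> (lo' + N' <= n)%N ->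
  forall i j, ((colblock Q lo N)^T *m colblock Q lo' N') i j = (lo + i == lo' + j)%N%:R.
Proof.
move=> h h' i j.
have hi : (lo + i < n)%N by apply: leq_trans h; rewrite ltn_add2l.
have hj : (lo' + j < n)%N by apply: leq_trans h'; rewrite ltn_add2l.
have := congr1 (fun M : 'M[R]_n => M (Ordinal hi) (Ordinal hj)) QTQ.
rewrite /= [RHS]mxE -val_eqE /= => <-; rewrite [LHS]mxE [RHS]mxE; apply: eq_bigr => l _.
by rewrite [in LHS]mxE [in RHS]mxE !colblockE.
Qed.

Lemma char_poly_group s : (1 <= s <= k)%N ->
  \det (Wmx K (Plt H s) (Plt H s)) != 0 ->
  \rank (Vmx x (Plt H s)) = size (Plt H s) ->
  let Qs := colblock Q (size (Plt H s)) (Ns H n s) in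
  let Vs := Vmx x (H s) in
  let Wt := Wmx K (H s) (H s) -
    Wmx K (H s) (Plt H s) *m invmx (Wmx K (Plt H s) (Plt H s)) *m Wmx K (Plt H s) (H s) in
  char_poly (Qs^T *m Vs *m Wt *m Vs^T *m Qs) = \prod_(i < n | grp H s i) ('X - (lt i)%:P).
Proof.
move=> /andP[s1 sk] W0 rV Qs Vs Wt; set Y1 := _ *m Qs.
set m := size (Plt H s) in Qs Y1 *; set N := Ns H n s in Qs Y1 *.
have mn : (m < n)%N.
  by case/andP: hn => + _; apply: leq_ltn_trans; exact: size_Plt_mono.
have mS : (m <= size (Plt H s.+1))%N by exact: size_Plt_mono.
have NE : (m + N)%N = minn (size (Plt H s.+1)) n.
  by rewrite /N /Ns subnKC // leq_min mS ltnW.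
have mNn : (m + N <= n)%N by rewrite NE geq_minr.
(* The later columns of [Q] complete [Qs] to a basis of the whole kernel of V_(<=s-1)^T, as
   [det_limit] requires. *)
pose r := (n - (m + N))%N; pose Qr := colblock Q (m + N) r.
have rn : (m + N + r <= n)%N by rewrite subnKC.
pose U := row_mx Qs Qr.
have En : (m + (N + r))%N = n by rewrite addnA subnKC.
have UU : U^T *m U = 1%:M.
  have g1 : Qs^T *m Qs = 1%:M.
    by apply/matrixP => i j; rewrite Q_gram // mxE eqn_add2l.
  have g2 : Qs^T *m Qr = 0.
    apply/matrixP => i j; rewrite Q_gram // mxE.
    by rewrite ltn_eqF // -addnA ltn_add2l ltn_addr.
  have g3 : Qr^T *m Qs = 0 by apply: trmx_inj; rewrite trmx_mul trmxK g2 trmx0.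
  have g4 : Qr^T *m Qr = 1%:M.
    by apply/matrixP => i j; rewrite Q_gram // mxE eqn_add2l.
  by rewrite tr_row_mx mul_col_row g1 g2 g3 g4 -scalar_mx_block.
have kerQ lo N' t : (lo + N' <= n)%N -> (size (Plt H t) <= lo)%N -> (t <= k)%N ->
    forall (i : 'I_N') a, (mdeg a < t)%N -> \sum_l colblock Q lo N' l i * mono a (x l) = 0.
  move=> hl tl tk i a at_.
  have hi : (lo + i < n)%N by apply: leq_trans hl; rewrite ltn_add2l.
  under eq_bigr do rewrite (colblockE _ _ hi).
  by apply: (@QR_col_orth t) => //=; apply: leq_trans tl (leq_addr _ _).
have UV : U^T *m Vmx x (Plt H s) = 0.
  apply/matrixP => i j; rewrite mxE [RHS]mxE.
  have aj : (mdeg (nth (mi0 d) (Plt H s) j) < s)%N by rewrite -(mem_Plt Hgr) mem_nth.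
  case: (split_ordP i) => i' ->.
    under eq_bigr do rewrite [U^T _ _]mxE row_mxEl [Vmx _ _ _ _]mxE.
    exact: (kerQ _ _ s).
  under eq_bigr do rewrite [U^T _ _]mxE row_mxEr [Vmx _ _ _ _]mxE.
  by apply: (kerQ _ _ s) => //; exact: leq_addr.
have VQr : Vs^T *m Qr = 0.
  apply/matrixP => j i; rewrite mxE [RHS]mxE.
  have mNi : (m + N + i < n)%N by apply: leq_trans rn; rewrite ltn_add2l.
  (* The column [i] of [Qr] exists only if group [s] ends before [n]; then [s < k], and [Qr] is
     orthogonal to the monomials of degree [s] too. *)
  have Sn : (m + N)%N = size (Plt H s.+1).
    have : (m + N < n)%N by apply: leq_ltn_trans mNi; exact: leq_addr.
    by rewrite NE gtn_min ltnn orbF => /ltnW/minn_idPl ->.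
  have sk' : (s.+1 <= k)%N.
    rewrite ltn_neqAle sk andbT; apply/eqP => sE.
    case/andP: hn => _; rewrite -sE -Sn leqNgt => /negP; apply.
    by apply: leq_ltn_trans mNi; exact: leq_addr.
  under eq_bigr do rewrite [Vs^T _ _]mxE [Vs _ _]mxE mulrC.
  apply: (kerQ _ _ s.+1) => //; first by rewrite Sn.
  have : nth (mi0 d) (H s) j \in H s by rewrite mem_nth.
  by rewrite mem_H // => /eqP ->.
have Wu : Wmx K (Plt H s) (Plt H s) \in unitmx by rewrite unitmxE unitfE.
have VV := row_free_gram_unit rV; have VV0 := VV; rewrite unitmxE unitfE in VV0.
pose Y := U^T *m Vs *m Wt *m Vs^T *m U.
have YE : Y = block_mx Y1 0 0 0.
  pose Z := Vs *m Wt *m Vs^T.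
  have QrV : Qr^T *m Vs = 0 by apply: trmx_inj; rewrite trmx_mul trmxK VQr trmx0.
  have ZQr : Z *m Qr = 0 by rewrite -mulmxA VQr mulmx0.
  have QrZ : Qr^T *m Z = 0 by rewrite !mulmxA QrV !mul0mx.
  have -> : Y = U^T *m Z *m U by rewrite /Y !mulmxA.
  rewrite tr_row_mx mul_col_mx mul_col_row QrZ !mul0mx -[_ *m Z *m Qr]mulmxA ZQr mulmx0.
  by rewrite /Y1 !mulmxA.
(* [det_limit] with [T = S] and [c = - z]: [det_gram_Wmx] accounts for the earlier groups, and
   cancelling det W_(s-1) leaves the Schur complement. *)
have main z : \det (Y - z%:M) = \prod_(i < n | (m <= i)%N) ((s == idx_deg i)%:R * lt i - z).
  have := @det_limit s s _ U (- z) sk _ s1 En VV UV; rewrite leqnn leqnSn => /(_ isT).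
  rewrite eqxx !scale1r det_schur // UU det1 scaleNr scalemx1.
  have -> : U^T *m Vmx x (H s) *m Wmx K (H s) (H s) *m (Vmx x (H s))^T *m U - z%:M -
    U^T *m Vmx x (H s) *m Wmx K (H s) (Plt H s) *m invmx (Wmx K (Plt H s) (Plt H s)) *m
      (Wmx K (Plt H s) (H s) *m (Vmx x (H s))^T *m U) = Y - z%:M.
    by rewrite addrAC /Y /Wt -/Vs mulmxBr !mulmxBl !mulmxA.
  rewrite (bigID (fun i => (idx_deg i < s)%N)) /=.
  rewrite (eq_bigr lt) => [|i ->//]; rewrite det_gram_Wmx ?s1 //.
  set P2 := \prod_(i < n | ~~ _) _.
  have -> : P2 = \prod_(i < n | (m <= i)%N) ((s == idx_deg i)%:R * lt i - z).
    rewrite /P2 /m; apply: eq_big => i; first by rewrite -idx_degP -leqNgt.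
    by move=> ngs; rewrite (negPf ngs) addnn -mul2n eqn_mul2l.
  rewrite mul1r mulrA (mulKf VV0) => /(mulfI W0) //.
(* [main] involves all indices from [m] on: the zero blocks of [Y] on one side and the [r] indices
   past group [s] on the other both contribute ['X^r]. *)
apply: (mulIf (monic_neq0 (monicXn R r))); apply: poly_ext => z.
rewrite !hornerM hornerXn char_poly_horner horner_prod.
have -> : \det (z%:M - Y1) * z ^+ r = \det (z%:M - Y).
  rewrite YE scalar_mx_block opp_block_mx add_block_mx !oppr0 !addr0.
  by rewrite det_lblock det_scalar.
rewrite -opprB -scaleN1r detZ main.
have -> : (-1) ^+ (N + r) = \prod_(i < n | (m <= i)%N) (-1 : R).
  by rewrite prod_const_ge -En addKn.
rewrite -big_split /= (bigID (fun i => grp H s i)) /=; congr (_ * _).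
  rewrite (eq_bigl (grp H s)) => [|i]; last first.
    by rewrite andb_idl // => /andP[].
  apply: eq_bigr => i; rewrite grpE => /eqP ->.
  by rewrite eqxx mul1r hornerXsubC mulN1r opprB.
rewrite (eq_bigl (fun i : 'I_n => (m + N <= i)%N)) => [|i]; last first.
  rewrite /grp -/m NE geq_min [(n <= i)%N]leqNgt ltn_ord orbF.
  case: (leqP m i) => mi /=; first by rewrite -leqNgt.
  by rewrite leqNgt (leq_trans mi mS).
rewrite -(prod_const_ge n z); apply: eq_bigr => i.
rewrite NE geq_min [(n <= i)%N]leqNgt ltn_ord orbF leqNgt idx_degP -leqNgt => si.
by rewrite ltn_eqF // mul0r; ring.
Qed.

(** Inner products of the limiting eigenvectors with the columns of [Q]; spans of groups agree when
    this orthogonal matrix is block diagonal. *)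
Let T := pm^T *m Q.

Let QQT : Q *m Q^T = 1%:M. Proof. exact: mulmx1C. Qed.
Let pmpmT : pm *m pm^T = 1%:M. Proof. exact: mulmx1C pm_gram. Qed.

Lemma limit_coef_neq0 S : (0 < S <= k)%N -> \det (Wmx K (Plt H S) (Plt H S)) != 0 ->
  \rank (Vmx x (Plt H S)) = size (Plt H S) -> forall i, (idx_deg i < S)%N -> lt i != 0.
Proof.
move=> hS W0 rV i iS; have := det_gram_Wmx hS.
have := row_free_gram_unit rV; rewrite unitmxE unitfE => V0 E.
have : \prod_(i < n | (idx_deg i < S)%N) lt i != 0 by rewrite E mulf_neq0.
by move=> /prodf_neq0; apply.
Qed.

(** The columns of [Q] past the cut are orthogonal to V_(<=S-1), so [limit_eigenvector_orth] clears
    one corner of [T]; [orthogonal_block] clears the other. *)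
Lemma cross_gram_eq0 S : (S <= k)%N -> (forall i, (idx_deg i < S)%N -> lt i != 0) ->
  forall i j : 'I_n, (i < size (Plt H S))%N != (j < size (Plt H S))%N -> T i j = 0.
Proof.
move=> Sk lt0.
have Z (i j : 'I_n) : (i < size (Plt H S))%N -> (size (Plt H S) <= j)%N -> T i j = 0.
  rewrite idx_degP => iS Sj.
  have u0 : (col j Q)^T *m Vmx x (Plt H S) = 0.
    apply/matrixP => a b; rewrite mxE [RHS]mxE.
    under eq_bigr do rewrite mxE [col _ _ _ _]mxE [Vmx _ _ _ _]mxE.
    apply: (QR_col_orth Sk Sj).
    by rewrite -(mem_Plt Hgr) mem_nth.
  rewrite -(limit_eigenvector_orth Sk iS (lt0 i iS) u0) !mxE.
  by apply: eq_bigr => a _; rewrite !mxE mulrC.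
have TT' : T *m T^T = 1%:M.
  by rewrite trmx_mul trmxK mulmxA -(mulmxA _ Q) QQT mulmx1 pm_gram.
have T'T : T^T *m T = 1%:M.
  by rewrite trmx_mul trmxK mulmxA -(mulmxA _ pm) pmpmT mulmx1 QTQ.
move=> i j; case: ltnP => iS; case: ltnP => // jS _; first exact: Z.
exact: orthogonal_block TT' T'T Z _ _ iS jS.
Qed.

Lemma span_block lo N : (lo + N <= n)%N ->
  (forall i j : 'I_n, (lo <= i < lo + N)%N != (lo <= j < lo + N)%N -> T i j = 0) ->
  ((colblock pm lo N)^T == (colblock Q lo N)^T)%MS.
Proof.
move=> loN T0; apply/andP; split.
  apply: (@colblock_sub _ _ _ _ T^T) => // [|l i ib lb].
    by rewrite trmx_mul trmxK mulmxA QQT mul1mx.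
  by rewrite mxE T0 // ib (negPf lb).
apply: (@colblock_sub _ _ _ _ T) => // [|l i ib lb].
  by rewrite mulmxA pmpmT mul1mx.
by rewrite T0 // ib (negPf lb).
Qed.

Lemma span_group s : (s < k)%N ->
  \det (Wmx K (Plt H s.+1) (Plt H s.+1)) != 0 ->
  \rank (Vmx x (Plt H s.+1)) = size (Plt H s.+1) ->
  ((colblock pm (size (Plt H s)) (Ns H n s))^T ==
   (colblock Q (size (Plt H s)) (Ns H n s))^T)%MS.
Proof.
move=> sk W0 rV; have lt0 := @limit_coef_neq0 s.+1 sk W0 rV.
(* Cuts at both ends of the group isolate its diagonal block. *)
have Z1 := cross_gram_eq0 sk lt0.
have Z0 := cross_gram_eq0 (ltnW sk) (fun i is_ => lt0 i (ltnW is_)).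
have mS : (size (Plt H s) <= size (Plt H s.+1))%N by exact: size_Plt_mono.
have Sn : (size (Plt H s.+1) <= n)%N.
  by case/andP: hn => /ltnW + _; apply: leq_trans; exact: size_Plt_mono.
have NE : (size (Plt H s) + Ns H n s)%N = size (Plt H s.+1).
  by rewrite /Ns (minn_idPl Sn) subnKC.
apply: span_block; rewrite NE // => i j ij.
have [E0|] := eqVneq (i < size (Plt H s))%N (j < size (Plt H s))%N; last exact: Z0.
apply: Z1; apply: contra_neq ij => E1.
by rewrite ![(size _ <= _)%N]leqNgt E0 E1.
Qed.

Lemma span_last : (0 < k)%N -> \det (Wmx K (Plt H k) (Plt H k)) != 0 ->
  \rank (Vmx x (Plt H k)) = size (Plt H k) ->
  ((colblock pm (size (Plt H k)) (Ns H n k))^T ==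
   (colblock Q (size (Plt H k)) (Ns H n k))^T)%MS.
Proof.
move=> k0 W0 rV; have hk : (0 < k <= k)%N by rewrite k0 leqnn.
have Z := cross_gram_eq0 (leqnn k) (limit_coef_neq0 hk W0 rV).
have NE : (size (Plt H k) + Ns H n k)%N = n.
  case/andP: hn => h1 h2.
  by rewrite /Ns (minn_idPr h2) subnKC // ltnW.
apply: span_block; rewrite NE // => i j; rewrite !ltn_ord !andbT => ij; apply: Z.
by rewrite ![(_ < size _)%N]ltnNge (inj_eq negb_inj).
Qed.

End QR.

End Eigenvalues.

Theorem theorem6p2 (R : realType) (d : nat) (H : nat -> seq (mi d))
  (Om : set 'rV[R]_d) (k n : nat) (K : 'rV[R]_d * 'rV[R]_d -> R)
  (x : 'I_n -> 'rV[R]_d) (e0 : R) :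
  graded_enum H ->
  open Om -> Om 0 ->
  (1 <= k)%N ->
  Ckk k.+1 Om K ->
  (size (Plt H k) < n <= size (Plt H k.+1))%N ->
  0 < e0 ->
  (forall e : R, 0 <= e <= e0 ->
     (Keps K x e)^T = Keps K x e /\ psdmx (Keps K x e)) ->
  mx_analytic0 (Keps K x) ->
  forall (lam : 'I_n -> R -> R) (P : 'I_n -> R -> 'M[R]_n)
         (p : 'I_n -> 'cV[R]_n) (del : R),
  0 < del ->
  (forall i, analytic0 (lam i) /\ mx_analytic0 (P i)) ->
  (forall e : R, 0 <= e < del ->
     Keps K x e = \sum_(i < n) lam i e *: P i e /\
     (forall i j : 'I_n, (P i e)^T = P i e /\
        P i e *m P j e = (if i == j then P i e else 0) /\
        \rank (P i e) = 1%N)) ->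
  (forall e : R, 0 < e < del ->
     forall i j : 'I_n, (i <= j)%N -> lam j e <= lam i e) ->
  (forall i, P i 0 = p i *m (p i)^T) ->
  exists lt : 'I_n -> R,
    (exists (C del' : R), 0 < del' /\
       forall e : R, 0 < e < del' -> forall (s : nat) (i : 'I_n), grp H s i ->
         `|lam i e - e ^+ (2 * s) * lt i| <= C * e ^+ (2 * s).+1) /\
    (forall i : 'I_n, val i = 0%N -> lt i = n%:R * K (0, 0)) /\
    (* 1. *)
    (forall s : nat, (1 <= s < k)%N ->
       \det (Wmx K (Plt H s) (Plt H s)) != 0 ->
       \rank (Vmx x (Plt H s)) = size (Plt H s) ->
       \prod_(i < n | grp H s i) lt i =
         \det ((Vmx x (Plt H s.+1))^T *m Vmx x (Plt H s.+1)) *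
         \det (Wmx K (Plt H s.+1) (Plt H s.+1)) /
         (\det ((Vmx x (Plt H s))^T *m Vmx x (Plt H s)) *
          \det (Wmx K (Plt H s) (Plt H s)))) /\
    (* full QR factorization V_{<= k-1} = Q_full [R; 0] *)
    (forall (Q : 'M[R]_n) (Rf : 'M[R]_(n, size (Plt H k))),
       Q^T *m Q = 1%:M ->
       (forall (i : 'I_n) (j : 'I_(size (Plt H k))), (j < i)%N -> Rf i j = 0) ->
       Vmx x (Plt H k) = Q *m Rf ->
       (* 2. *)
       (forall s : nat, (1 <= s <= k)%N ->
          \det (Wmx K (Plt H s) (Plt H s)) != 0 ->
          \rank (Vmx x (Plt H s)) = size (Plt H s) ->
          let Qs := colblock Q (size (Plt H s)) (Ns H n s) in
          let Vs := Vmx x (H s) in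
          let Wt := Wmx K (H s) (H s) -
                    Wmx K (H s) (Plt H s) *m invmx (Wmx K (Plt H s) (Plt H s))
                      *m Wmx K (Plt H s) (H s) in
          char_poly (Qs^T *m Vs *m Wt *m Vs^T *m Qs) =
            \prod_(i < n | grp H s i) ('X - (lt i)%:P)) /\
       (* 3. *)
       (forall s : nat, (s < k)%N ->
          \det (Wmx K (Plt H s.+1) (Plt H s.+1)) != 0 ->
          \rank (Vmx x (Plt H s.+1)) = size (Plt H s.+1) ->
          ((colblock (\matrix_(a, b) p b a 0) (size (Plt H s)) (Ns H n s))^T ==
           (colblock Q (size (Plt H s)) (Ns H n s))^T)%MS) /\
       (\det (Wmx K (Plt H k) (Plt H k)) != 0 ->
        \rank (Vmx x (Plt H k)) = size (Plt H k) ->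
        ((colblock (\matrix_(a, b) p b a 0) (size (Plt H k)) (Ns H n k))^T ==
         (colblock Q (size (Plt H k)) (Ns H n k))^T)%MS)).
Proof.
move=> Hgr Om_open Om0 k1 KC hn e0_gt0 Kpsd _ lam P p del del_gt0 lamP spectral sorted Pp.
have /choice[lt lt_spec] := lam_leading Hgr Om_open Om0 KC hn e0_gt0 Kpsd del_gt0 lamP
  spectral sorted.
exists lt; split; [|split; [|split]].
- have /choice[C hC] := lt_spec.
  (* The remainder needs one threshold and one constant for the finitely many eigenvalues. *)
  have : \forall e \near (0 : R)^'+, forall i, `|lam i e - e ^+ (2 * idx_deg H k i) * lt i| <=
      C i * e ^+ (2 * idx_deg H k i).+1.
    apply: filter_forall => i; have [b [b0 hb]] := hC i.
    by apply: filterS (near_small b0) => e; exact: hb.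
  case=> b /= b0 hb; exists (\sum_i `|C i|), b; split => // e /andP[e_gt0 eb] s i.
  rewrite (grpE Hgr hn) => /eqP <-; apply: le_trans (hb e _ e_gt0 i) _.
    by rewrite /= sub0r normrN gtr0_norm.
  apply: ler_wpM2r; first by rewrite exprn_ge0 // ltW.
  apply: le_trans (ler_norm _) _; rewrite (bigD1 i) //= lerDl sumr_ge0 //.
- exact: (limit_coef_first Hgr hn del_gt0 lamP spectral lt_spec).
- exact: (prod_lt_grp Hgr Om_open Om0 KC hn e0_gt0 Kpsd del_gt0 spectral sorted lt_spec).
- move=> Q Rf QTQ Rf_upper VQR; split; [|split].
  + exact: (char_poly_group Hgr Om_open Om0 KC hn e0_gt0 Kpsd del_gt0 spectral sorted
      lt_spec QTQ Rf_upper VQR).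
  + exact: (span_group Hgr Om_open Om0 KC hn e0_gt0 Kpsd del_gt0 lamP spectral sorted
      lt_spec Pp QTQ Rf_upper VQR).
  + exact: (span_last Hgr Om_open Om0 KC hn e0_gt0 Kpsd del_gt0 lamP spectral sorted
      lt_spec Pp QTQ Rf_upper VQR k1).
Qed.
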